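(* Let $\mathfrak{R}(h,z)$ be the Riemann surface of the algebraic function $h$ of third order defined by $$h^3-3\,\frac{P_2(z)}{\Pi_4(z)}\,h+2\,\frac{P_1(z)}{\Pi_4(z)}=0,$$ where $$\Pi_4(x)=\prod_{j=1}^2(x-a_j)(x-b_j)=x^4-s_1x^3+s_2x^2-s_3x+s_4,\qquad P_1(z)=z-c,\qquad P_2(z)=z^2-\frac{s_1+2c}{3}\,z+d,$$ with $a_1,b_1,a_2,b_2,c,d\in\mathbb{C}$. Put $$K_2(x):=3x^2+2(c-s_1)\,x-3d+s_2 ,$$ and let $\mathfrak{H}(\Delta,R)$ be the two-sheeted Riemann surface of the algebraic curve $$\Delta^2-\left(\Pi_4'(R)\right)^2+4\,\Pi_4(R)\,K_2(R)=0 .$$ Then a conformal equivalence of the Riemann surfaces $\mathfrak{R}(h,z)$ and $\mathfrak{H}(\Delta,R)$ is established by the formulas $$R=z-\frac1h,\qquad \Delta=\frac{2K_2\left(z-\frac1h\right)}{h}+\Pi_4'\left(z-\frac1h\right),$$ and the inverse map is given by $$z=R+\frac{-\Pi_4'(R)+\Delta}{2K_2(R)},\qquad h=-\frac{\Pi_4'(R)+\Delta}{2\,\Pi_4(R)} .$$ In particular, in the new variables $(\Delta,R)$ the equation of the algebraic curve defining $h$ becomes $\Delta^2-\left(\Pi_4'(R)\right)^2+4\,\Pi_4(R)K_2(R)=0$.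
   Context: Here $\Pi_4'$ denotes the derivative of the polynomial $\Pi_4$ with respect to its variable. An algebraic function $h$ of third order satisfies, by convention, an irreducible cubic equation with coefficients polynomial (after clearing denominators) in $z$; its Riemann surface $\mathfrak{R}(h,z)$ is the compact three-sheeted branched covering of the extended complex plane $\overline{\mathbb{C}}$ (the $z$-sphere) on which $h$ is a single-valued meromorphic function. Likewise $\mathfrak{H}(\Delta,R)$ is the compact two-sheeted branched covering of the $R$-sphere on which $\Delta$ is single-valued. The formulas are understood as identities between meromorphic functions on these compact Riemann surfaces. *)

(* Defs.v *)
(* MathComp-Analysis, over the complex numbers R[i] of an arbitrary R : realType. *)
From HB Require Import structures.
From mathcomp Require Import all_boot all_order all_algebra.
From mathcomp Require Import complex.
From mathcomp Require Import all_classical all_reals all_analysis.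

Set Implicit Arguments.
Unset Strict Implicit.
Unset Printing Implicit Defensive.

Import Order.TTheory GRing.Theory Num.Theory.
Import numFieldNormedType.Exports.

Local Open Scope classical_set_scope.
Local Open Scope card_scope.
Local Open Scope ring_scope.

(* Naming the structure (rather than writing R[i]) gives C the topology induced
   by its modulus, through the canonical topology of a numFieldType. *)
Definition cplx (R : realType) : numClosedFieldType := R[i]%C.

(* Ccirc: None is the point at infinity. *)
Definition sphere (R : realType) := one_point_compactification (cplx R).

Definition sphere_inv (R : realType) (w : sphere R) : sphere R :=
  if w is Some x then (if x == 0 then None else Some x^-1) else Some 0.

(* Meromorphic functions on a compact Riemann surface are equal as soon as they
   agree off a finite set; identities between them are stated in this way. *)
Definition generically (T : Type) (P : T -> Prop) : Prop :=
  finite_set [set x | ~ P x].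

(* f is holomorphic at a: near a, it is the sum of a convergent power series. *)
Definition holomorphic_at (R : realType) (f : cplx R -> cplx R) (a : cplx R) :=
  exists u : nat -> cplx R, \forall w \near a,
    series (fun n => u n * (w - a) ^+ n) @ \oo --> f w.

Record chart (R : realType) (X : topologicalType) := Chart {
  chart_dom : set X ;
  chart_coord :> X -> cplx R ;
  chart_param : cplx R -> X ;
  chart_dom_open : open chart_dom ;
  chart_cod_open : open (chart_coord @` chart_dom) ;
  chart_coordK : forall x, chart_dom x -> chart_param (chart_coord x) = x ;
  chart_coord_continuous : forall x, chart_dom x ->
    {for x, continuous chart_coord} ;
  chart_param_continuous : forall w, (chart_coord @` chart_dom) w ->
    {for w, continuous chart_param}
}.

Definition holomorphic_transition (R : realType) (X : topologicalType)
    (t1 t2 : chart R X) : Prop :=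
  forall x, chart_dom t1 x -> chart_dom t2 x ->
    holomorphic_at (t2 \o chart_param t1) (t1 x).

Record riemann_surface (R : realType) := RiemannSurface {
  rs_space :> topologicalType ;
  rs_atlas : set (chart R rs_space) ;
  rs_hausdorff : hausdorff_space rs_space ;
  rs_connected : connected [set: rs_space] ;
  rs_cover : forall x : rs_space, exists2 t, rs_atlas t & chart_dom t x ;
  rs_compatible : forall t1 t2, rs_atlas t1 -> rs_atlas t2 ->
    holomorphic_transition t1 t2
}.

(* t belongs to the maximal atlas of X and vanishes at x. *)
Definition local_coordinate (R : realType) (X : riemann_surface R)
    (t : chart R X) (x : X) : Prop :=
  [/\ chart_dom t x, t x = 0 &
      forall t', rs_atlas t' ->
        holomorphic_transition t t' /\ holomorphic_transition t' t].

Definition holomorphic_map (R : realType) (X Y : riemann_surface R)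
    (F : X -> Y) : Prop :=
  continuous F /\
  forall (t : chart R X) (t' : chart R Y), rs_atlas t -> rs_atlas t' ->
    forall x, chart_dom t x -> chart_dom t' (F x) ->
      holomorphic_at (t' \o F \o chart_param t) (t x).

Definition conformal_equivalence (R : realType) (X Y : riemann_surface R)
    (phi : X -> Y) (psi : Y -> X) : Prop :=
  [/\ cancel phi psi, cancel psi phi, holomorphic_map phi & holomorphic_map psi].

(* A holomorphic map to the sphere, not identically infinite (X is connected). *)
Definition meromorphic (R : realType) (X : riemann_surface R)
    (f : X -> sphere R) : Prop :=
  (forall (t : chart R X) x, rs_atlas t -> chart_dom t x ->
     exists g : cplx R -> cplx R, holomorphic_at g (t x) /\
       ((\forall y \near x, f y = Some (g (t y))) \/
        (\forall y \near x, f y = sphere_inv (Some (g (t y)))))) /\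
  exists x, f x <> None.

(* In suitable local coordinates t, z is z0 + t^k, or t^-k over infinity. *)
Definition branched_covering (R : realType) (X : riemann_surface R)
    (z : X -> sphere R) : Prop :=
  forall x, exists (t : chart R X) (k : nat),
    [/\ local_coordinate t x, (0 < k)%N &
       (exists z0, \forall y \near x, z y = Some (z0 + t y ^+ k)) \/
       (\forall y \near x, z y = sphere_inv (Some (t y ^+ k)))].

Definition sheeted (R : realType) (n : nat) (X : riemann_surface R)
    (z : X -> sphere R) : Prop :=
  branched_covering z /\
  generically (fun w : sphere R => z @^-1` [set w] #= `I_n).

(* Polynomials in two variables: P : {poly {poly C}} is a polynomial in the
   algebraic function h, with coefficients in C[z]; P(z0, h0) is as follows. *)
Definition eval2 (R : realType) (P : {poly {poly cplx R}}) (z0 h0 : cplx R) :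
    cplx R := P.[h0%:P].[z0].

(* Irreducibility in C[z][h]; irreducible_poly would ignore factors in C[z]. *)
Definition irreducible2 (R : realType) (P : {poly {poly cplx R}}) : Prop :=
  [/\ P != 0, P \isn't a GRing.unit &
      forall A B, P = A * B -> A \is a GRing.unit \/ B \is a GRing.unit].

(* (X, z, h) is the Riemann surface of the algebraic function h of z given by
   P(z, h) = 0. The last clause says that h is a single-valued function on X,
   whose values on the sheets are the branches: over all but finitely many z0,
   the points of X correspond, through h, to the roots of P(z0, -). *)
Definition riemann_surface_of (R : realType) (P : {poly {poly cplx R}})
    (X : riemann_surface R) (z h : X -> sphere R) : Prop :=
  [/\ compact [set: X],
      sheeted (size P).-1 z,
      meromorphic h &
      generically (fun z0 : cplx R =>
        set_bij (z @^-1` [set Some z0])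
                (Some @` [set h0 | eval2 P z0 h0 = 0]) h)].

Definition cubic_curve (R : realType) (Pi4 P2 P1 : {poly cplx R}) :
    {poly {poly cplx R}} :=
  Pi4%:P * 'X^3 - (3 *: P2)%:P * 'X + (2 *: P1)%:P.

Definition hyperelliptic_curve (R : realType) (Pi4 K2 : {poly cplx R}) :
    {poly {poly cplx R}} :=
  'X^2 - (Pi4^`() ^+ 2)%:P + (4 *: (Pi4 * K2))%:P.

(* Main.v *)
Require Import Defs.
From HB Require Import structures.
From mathcomp Require Import all_boot all_order all_algebra.
From mathcomp Require Import complex.
From mathcomp Require Import all_classical all_reals all_analysis.
From mathcomp Require Import ring lra.
From mathcomp Require Import cyclic separable cyclotomic.

(** Why the theorem is true.

    The algebra is Taylor's formula. Put x = z - 1/h and xi = 1/h. The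
    polynomials P1 and P2 are such that the cubic equation, divided by h^3, reads

      Pi4(x) + Pi4'(x) xi + K2(x) xi^2 = 0

    (cubic_taylor). For fixed x this is quadratic in xi; its discriminant is
    Pi4'(x)^2 - 4 Pi4(x) K2(x), and Delta = 2 K2(x) xi + Pi4'(x) is a square
    root of it. Solving for xi in the two usual ways recovers z and h
    (direct_formulas, inverse_formulas). Irreducibility of the cubic excludes
    that the quadratic in xi, for some x, or the cubic in h, for some z, vanishes
    identically (quadratic_neq0, fibre_cubic_neq0). Hence each x is attained
    over finitely many z only and conversely, and the formulas define bijections,
    inverse to each other, between cofinite sets X0 of X and Y0 of Y.

    It remains to extend the bijections to holomorphic maps of the compact
    surfaces; then they are inverse to each other everywhere, since cofinite sets
    are dense. The extension lifts the meromorphic function z - 1/h on X through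
    the branched covering r of the sphere by Y (holomorphic_lift), and in the
    same way a meromorphic function on Y through z. On X0 the lift is
    continuous since (r, Delta) is a continuous, hence closed, map on a compact
    space, injective on the fibres in question (lift_continuous). At any point x0
    of X a lift has a limit: its cluster values lie in a fibre of r, which is
    discrete, and a punctured disc is connected (punctured_disc_limit). In a
    coordinate in which r is t |-> t^k, the lift is a continuous k-th root of a
    holomorphic function (w - a)^m u(w) on a punctured disc. Its monodromy is
    trivial, which forces k to divide m, and then it is, up to a constant,
    (w - a)^(m/k) times a holomorphic k-th root of u (root_removable). So
    neither Cauchy's theorem nor Riemann's theorem on removable singularities
    is called for.

    What this uses from function theory are operations on convergent power
    series: products, composites, inverses, k-th roots. A power series is handled
    through its truncations, which are polynomials; they are compared coefficient
    by coefficient and estimated in an l^1 norm (holo_criterion). *)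

Set Implicit Arguments.
Unset Strict Implicit.
Unset Printing Implicit Defensive.

Import Order.TTheory GRing.Theory Num.Theory.
Import numFieldNormedType.Exports.

Local Open Scope classical_set_scope.
Local Open Scope ring_scope.

(** * The modulus of a complex number *)

Section modulus.
Variable R : realType.
Local Notation C := (cplx R).

(** The modulus with values in R rather than in the ordered field C itself, so
    that estimates take place in a totally ordered field. *)
Definition md (x : C) : R := Normc.normc x.

Lemma normE (x : C) : `|x| = (md x)%:C%C.
Proof. by []. Qed.

Lemma real_complex_lt (x y : R) : ((x%:C)%C < (y%:C)%C :> C) = (x < y).
Proof. by rewrite ltcE /= eqxx. Qed.

Lemma real_complex_le (x y : R) : ((x%:C)%C <= (y%:C)%C :> C) = (x <= y).
Proof. by rewrite lecE /= eqxx. Qed.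

Lemma pos_complexE (e : C) : 0 < e -> e = ((complex.Re e)%:C)%C /\ 0 < complex.Re e.
Proof.
by case: e => x y; rewrite ltcE /= => /andP[/eqP-> ->].
Qed.

Lemma md_ge0 (x : C) : 0 <= md x.
Proof. by have := normr_ge0 x; rewrite normE -[0]/((0 : R)%:C)%C real_complex_le. Qed.

Lemma md0 : md 0 = 0.
Proof. exact: Normc.normc0. Qed.
Lemma md1 : md 1 = 1.
Proof. exact: Normc.normc1. Qed.
Lemma mdM (x y : C) : md (x * y) = md x * md y.
Proof. exact: Normc.normcM. Qed.
Lemma mdV (x : C) : md x^-1 = (md x)^-1.
Proof. exact: Normc.normcV. Qed.
Lemma mdX (x : C) n : md (x ^+ n) = md x ^+ n.
Proof. by elim: n => [|n IH]; rewrite ?expr0 ?md1 // !exprS mdM IH. Qed.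
Lemma mdD (x y : C) : md (x + y) <= md x + md y.
Proof. exact: le_normcD. Qed.
Lemma mdN (x : C) : md (- x) = md x.
Proof. exact: normcN. Qed.
Lemma md_eq0 (x : C) : (md x == 0) = (x == 0).
Proof.
apply/eqP/eqP => [|->]; first exact: Normc.eq0_normc.
exact: md0.
Qed.
Lemma md_gt0 (x : C) : (0 < md x) = (x != 0).
Proof. by rewrite lt_def md_ge0 andbT md_eq0. Qed.
Lemma mdB (x y : C) : md (x - y) = md (y - x).
Proof. by rewrite -opprB mdN. Qed.
Lemma md_real (x : R) : md (x%:C)%C = `|x|.
Proof. by rewrite /md /Normc.normc /= expr0n addr0 sqrtr_sqr. Qed.

Lemma md_i : md (0 +i* 1 : C)%C = 1.
Proof. by rewrite /md /Normc.normc expr0n add0r expr1n sqrtr1. Qed.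

Lemma Re_Im_le_md (x : C) : `|complex.Re x| <= md x /\ `|complex.Im x| <= md x.
Proof.
case: x => x y /=; rewrite /md /= -!sqrtr_sqr.
by split; apply: ler_wsqrtr; rewrite ?lerDl ?lerDr sqr_ge0.
Qed.

Lemma md_sum (I : Type) (s : seq I) (P : pred I) (F : I -> C) :
  md (\sum_(i <- s | P i) F i) <= \sum_(i <- s | P i) md (F i).
Proof.
elim/big_rec2: _ => [|i y x Pi H]; first by rewrite md0.
by apply: (le_trans (mdD _ _)); rewrite lerD2l.
Qed.

Lemma nbhs_md (a : C) (P : set C) :
  (\forall w \near a, P w) <->
  exists2 e : R, 0 < e & forall w, md (w - a) < e -> P w.
Proof.
split=> [/nbhs_ballP[e /= /pos_complexE[eE e0] eP]|[e e0 eP]].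
  exists (complex.Re e) => // w wa; apply: eP.
  by rewrite -ball_normE /= eE normE real_complex_lt mdB.
apply/nbhs_ballP; exists (e%:C)%C; first by rewrite /= -[0]/((0 : R)%:C)%C real_complex_lt.
by move=> w; rewrite -ball_normE /= normE real_complex_lt mdB; apply: eP.
Qed.

Lemma cvg_md (T : Type) (F : set_system T) {FF : Filter F} (f : T -> C) (l : C) :
  f @ F --> l <-> forall e : R, 0 < e -> \forall t \near F, md (f t - l) < e.
Proof.
split=> [/cvgrPdist_lt H e e0|H].
  have /H : (0 : C) < (e%:C)%C by rewrite -[0]/((0 : R)%:C)%C real_complex_lt.
  by apply: filterS => t; rewrite normE real_complex_lt mdB.
apply/cvgrPdist_lt => e /pos_complexE[-> e0].
by apply: filterS (H _ e0) => t; rewrite normE real_complex_lt mdB.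
Qed.

Lemma cvg_md_le (T : Type) (F : set_system T) {FF : Filter F} (f : T -> C) (l : C)
    (b : T -> R) :
  (\forall t \near F, md (f t - l) <= b t) -> b @ F --> (0 : R) -> f @ F --> l.
Proof.
move=> fb /cvgrPdist_lt b0; apply/cvg_md => e /b0.
apply: filterS2 fb => t H; rewrite sub0r normrN.
by move=> H'; apply: le_lt_trans H (le_lt_trans _ H'); exact: ler_norm.
Qed.

End modulus.

(** * Norms and jets of polynomials *)

Section weight.
Variable R : realType.
Local Notation C := (cplx R).
Implicit Types (p q : {poly C}) (r : R).

(** The l^1 norm of the coefficients of p(r X): it is submultiplicative and
    bounds p on the disc of radius r. *)
Definition wt r p : R := \sum_(i < size p) md p`_i * r ^+ i.

Lemma wtE r p n : (size p <= n)%N -> wt r p = \sum_(i < n) md p`_i * r ^+ i.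
Proof.
move=> pn; rewrite /wt (big_ord_widen n (fun i => md p`_i * r ^+ i)) //.
rewrite big_mkcond; apply: eq_bigr => i _; case: ltnP => // ip.
by rewrite nth_default // md0 mul0r.
Qed.

Lemma wt_ge0 r p : 0 <= r -> 0 <= wt r p.
Proof. by move=> r0; apply: sumr_ge0 => i _; rewrite mulr_ge0 ?md_ge0 ?exprn_ge0. Qed.

Lemma wt0 r : wt r 0 = 0.
Proof. by rewrite /wt size_poly0 big_ord0. Qed.

Lemma wtD r p q : 0 <= r -> wt r (p + q) <= wt r p + wt r q.
Proof.
move=> r0; have [sp sq] := (leq_maxl (size p) (size q), leq_maxr (size p) (size q)).
rewrite (wtE r (size_polyD p q)) (wtE r sp) (wtE r sq) -big_split /=.
apply: ler_sum => i _; rewrite coefD -mulrDl ler_wpM2r ?exprn_ge0 //.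
exact: mdD.
Qed.

Lemma wtN r p : wt r (- p) = wt r p.
Proof. by rewrite /wt size_polyN; apply: eq_bigr => i _; rewrite coefN mdN. Qed.

Lemma wtZ r (a : C) p : wt r (a *: p) = md a * wt r p.
Proof.
rewrite (wtE r (size_scale_leq a p)) /wt mulr_sumr; apply: eq_bigr => i _.
by rewrite coefZ mdM mulrA.
Qed.

Lemma wt_cons r p (c : C) : wt r (p * 'X + c%:P) = wt r p * r + md c.
Proof.
rewrite (@wtE r (p * 'X + c%:P) (size p).+1); last first.
  rewrite (leq_trans (size_polyD _ _)) // geq_max (leq_trans (size_polyC_leq1 c)) // andbT.
  by rewrite (leq_trans (size_polyMleq _ _)) // size_polyX addn2.
rewrite big_ord_recl /= expr0 mulr1 coefD coefMX /= add0r coefC /= addrC; congr (_ + _).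
rewrite /wt mulr_suml; apply: eq_bigr => i _.
by rewrite /bump /= add1n coefD coefMX coefC /= addr0 exprSr mulrA.
Qed.

Lemma wtM r p q : 0 <= r -> wt r (p * q) <= wt r p * wt r q.
Proof.
move=> r0; elim/poly_ind: p => [|p c IH]; first by rewrite mul0r !wt0 mul0r.
have -> : (p * 'X + c%:P) * q = p * q * 'X + (0 : C)%:P + c *: q.
  by rewrite polyC0 addr0 -mul_polyC; ring.
apply: (le_trans (wtD _ _ r0)).
rewrite wt_cons md0 addr0 wtZ wt_cons mulrDl lerD2r mulrAC.
by rewrite ler_wpM2r.
Qed.

Lemma wt1 r : wt r 1 = 1.
Proof. by rewrite /wt size_poly1 big_ord1 coef1 eqxx mulr1n md1 expr0 mulr1. Qed.

Lemma wtX r p k : 0 <= r -> wt r (p ^+ k) <= wt r p ^+ k.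
Proof.
move=> r0; elim: k => [|k IH]; first by rewrite !expr0 wt1.
rewrite !exprS (le_trans (wtM _ _ r0)) // ler_wpM2l //; exact: wt_ge0.
Qed.

Lemma wt_comp r s p q : 0 <= r -> wt r q <= s -> wt r (p \Po q) <= wt s p.
Proof.
move=> r0 qs; have s0 : 0 <= s by apply: le_trans qs; exact: wt_ge0.
elim/poly_ind: p => [|p c IH]; first by rewrite comp_poly0 !wt0.
rewrite comp_polyD comp_polyM comp_polyX comp_polyC wt_cons.
apply: (le_trans (wtD _ _ r0)); apply: lerD.
  apply: (le_trans (wtM _ _ r0)); apply: ler_pM => //; exact: wt_ge0.
rewrite -[c%:P]add0r -[0](mul0r 'X) wt_cons wt0 mul0r add0r //.
Qed.

Lemma wt_mono r s p : 0 <= r -> r <= s -> wt r p <= wt s p.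
Proof.
move=> r0 rs; apply: ler_sum => i _; rewrite ler_wpM2l ?md_ge0 //.
by rewrite lerXn2r // nnegrE // (le_trans r0).
Qed.

Lemma wt_shrink r s p : 0 <= r -> r <= s -> p`_0 = 0 -> wt r p * s <= r * wt s p.
Proof.
move=> r0 rs p0; rewrite mulr_suml mulr_sumr; apply: ler_sum => -[[|i] ip] _ /=.
  by rewrite p0 md0 !(mul0r, mulr0).
have h : r ^+ i <= s ^+ i by rewrite lerXn2r // nnegrE // (le_trans r0).
have -> : md p`_i.+1 * r ^+ i.+1 * s = md p`_i.+1 * (r * s) * r ^+ i.
  by rewrite exprSr; ring.
have -> : r * (md p`_i.+1 * s ^+ i.+1) = md p`_i.+1 * (r * s) * s ^+ i.
  by rewrite exprSr; ring.
by rewrite ler_wpM2l // !mulr_ge0 ?md_ge0 // (le_trans r0).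
Qed.

Lemma wt_horner r p (x : C) : md x <= r -> md p.[x] <= wt r p.
Proof.
move=> xr; have r0 : 0 <= r by apply: le_trans xr; exact: md_ge0.
rewrite horner_coef; apply: (le_trans (md_sum _ _ _)); apply: ler_sum => i _.
rewrite mdM mdX ler_wpM2l ?md_ge0 // lerXn2r // nnegrE; exact: md_ge0.
Qed.

(** Equality of n-jets at 0. Read as divisibility of p - q by X^n, it passes to
    products and, when the inner polynomials vanish at 0, to composites. *)
Definition eqm n p q := forall i, (i < n)%N -> p`_i = q`_i.

Lemma eqmP n p q : eqm n p q <-> exists s, p = q + s * 'X^n.
Proof.
split=> [pq|[s ->] i i_n]; last by rewrite coefD coefMXn i_n addr0.
exists (drop_poly n (p - q)); rewrite -[LHS](subrK q) addrC; congr (_ + _).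
rewrite -[LHS](poly_take_drop n) [take_poly _ _](_ : _ = 0) ?add0r //.
apply/polyP => i; rewrite coef_take_poly coef0; case: ltnP => // i_n.
by rewrite coefB pq // subrr.
Qed.

Lemma eqmM n p p' q q' : eqm n p p' -> eqm n q q' -> eqm n (p * q) (p' * q').
Proof.
move=> /eqmP[s ->] /eqmP[t ->]; apply/eqmP.
exists (p' * t + s * q' + s * t * 'X^n); ring.
Qed.

Lemma eqm_comp n p p' q q' :
  q'`_0 = 0 -> eqm n p p' -> eqm n q q' -> eqm n (p \Po q) (p' \Po q').
Proof.
move=> q0 pp' /eqmP[t ->].
have [u q'E] : exists u, q' = u * 'X.
  have /eqmP[u ->] : eqm 1 q' 0 by case=> // _; rewrite q0 coef0.
  by exists u; rewrite add0r expr1.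
have H a : exists s, a \Po (q' + t * 'X^n) = a \Po q' + s * 'X^n.
  elim/poly_ind: a => [|a c [s IH]]; first by exists 0; rewrite !comp_poly0; ring.
  exists ((a \Po q') * t + s * q' + s * t * 'X^n).
  rewrite !comp_polyD !comp_polyM !comp_polyX !comp_polyC IH; ring.
have [s ->] := H p; move: pp' => /eqmP[v ->]; apply/eqmP.
exists ((v \Po q') * u ^+ n + s).
rewrite comp_polyD comp_polyM comp_Xn_poly q'E exprMn; ring.
Qed.

(** Schwarz's lemma for polynomials: what starts in degree n is of order
    (|x|/r)^n. *)
Lemma eqm_horner r n p q (x : C) : 0 < r -> eqm n p q -> md x <= r ->
  md (p.[x] - q.[x]) <= (md x / r) ^+ n * (wt r p + wt r q).
Proof.
move=> r0 pq xr; rewrite -hornerN -hornerD.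
have : wt r (p - q) <= wt r p + wt r q by rewrite -[wt r q]wtN wtD // ltW.
have : forall i, (i < n)%N -> (p - q)`_i = 0 by move=> i /pq; rewrite coefB => ->; rewrite subrr.
move: (p - q) => {pq}d d0 /(ler_wpM2l (exprn_ge0 n (divr_ge0 (md_ge0 x) (ltW r0)))).
apply: le_trans; rewrite horner_coef; apply: (le_trans (md_sum _ _ _)).
rewrite /wt mulr_sumr; apply: ler_sum => i _; rewrite mdM mdX.
have [/d0 ->|n_i] := ltnP i n; first by rewrite md0 !(mul0r,mulr0).
rewrite mulrCA ler_wpM2l ?md_ge0 //.
rewrite -(subnKC n_i) !exprD expr_div_n mulrA divfK ?expf_neq0 ?gt_eqF //.
rewrite ler_wpM2l ?exprn_ge0 ?md_ge0 // lerXn2r // nnegrE ?md_ge0 ?ltW //.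
Qed.

(** The mean value inequality on the disc of radius r/2; it rests on
    i (r/2)^(i-1) <= r^(i-1). *)
Lemma horner_lip r p (x y : C) : 0 < r -> md x <= r / 2 -> md y <= r / 2 ->
  md (p.[x] - p.[y]) * r <= md (x - y) * wt r p.
Proof.
move=> r0 xr yr.
have pow i : md (x ^+ i - y ^+ i) * r <= md (x - y) * r ^+ i.
  elim: i => [|i IH]; first by rewrite !expr0 subrr md0 mul0r mulr1 md_ge0.
  case: i IH => [|i] IH; first by rewrite !expr1.
  have -> : x ^+ i.+2 - y ^+ i.+2 = x * (x ^+ i.+1 - y ^+ i.+1) + (x - y) * y ^+ i.+1.
    rewrite !exprS; ring.
  have h1 : md x * (md (x ^+ i.+1 - y ^+ i.+1) * r) <= r / 2 * (md (x - y) * r ^+ i.+1).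
    by apply: ler_pM => //; rewrite ?mulr_ge0 ?md_ge0 // ltW.
  have h2 : md y ^+ i.+1 <= r ^+ i.+1 / 2.
    rewrite exprSr [r ^+ _]exprSr -mulrA ler_pM ?exprn_ge0 ?md_ge0 //.
    rewrite lerXn2r // ?nnegrE ?md_ge0 ?ltW //.
    by rewrite (le_lt_trans yr) // ltr_pdivrMr // ltr_pMr // ltr1n.
  apply: (@le_trans _ _ ((md x * md (x ^+ i.+1 - y ^+ i.+1) + md (x - y) * md y ^+ i.+1) * r)).
    by rewrite ler_wpM2r ?(ltW r0) // (le_trans (mdD _ _)) // !mdM mdX lexx.
  have h3 : md (x - y) * md y ^+ i.+1 * r <= md (x - y) * (r ^+ i.+1 / 2) * r.
    by rewrite ler_wpM2r ?(ltW r0) // ler_wpM2l ?md_ge0.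
  rewrite mulrDl -mulrA; apply: (le_trans (lerD h1 h3)).
  by rewrite [r ^+ i.+2]exprSr le_eqVlt; apply/orP; left; apply/eqP; field.
rewrite !horner_coef -sumrB /wt mulr_sumr.
apply: (@le_trans _ _ ((\sum_(i < size p) md (p`_i * x ^+ i - p`_i * y ^+ i)) * r)).
  by rewrite ler_wpM2r ?(ltW r0) // md_sum.
rewrite mulr_suml; apply: ler_sum => i _.
by rewrite -mulrBr mdM -mulrA [leRHS]mulrCA ler_wpM2l ?md_ge0.
Qed.

End weight.

(** * Power series *)

Section analytic.
Variable R : realType.
Local Notation C := (cplx R).
Implicit Types (c : nat -> C) (p q : {poly C}) (r : R) (f g : C -> C) (a : C).

Definition trunc c n : {poly C} := \poly_(i < n) c i.

Lemma coef_trunc c n i : (trunc c n)`_i = if (i < n)%N then c i else 0.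
Proof. by rewrite coef_poly. Qed.

Lemma horner_trunc c n (x : C) :
  (trunc c n).[x] = series (fun k => c k * x ^+ k) n.
Proof. by rewrite horner_poly seriesEord. Qed.

Lemma horner_truncE c (x : C) :
  (fun n => (trunc c n).[x]) = series (fun k => c k * x ^+ k).
Proof. by apply/funext => n; rewrite horner_trunc. Qed.

Lemma wt_trunc c n r : wt r (trunc c n) = \sum_(i < n) md (c i) * r ^+ i.
Proof.
rewrite (wtE r (size_poly n c)); apply: eq_bigr => i _.
by rewrite coef_trunc ltn_ord.
Qed.

Lemma eqm_trunc c m n : (m <= n)%N -> eqm m (trunc c n) (trunc c m).
Proof. by move=> mn i im; rewrite !coef_trunc im (leq_trans im). Qed.

(** A quantitative form of holomorphy: L bounds the series of the moduli of the
    terms on the circle of radius r. *)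
Definition power_series c r L f a :=
  [/\ 0 < r, forall n, wt r (trunc c n) <= L &
      forall x, md x < r -> (trunc c n).[x] @[n --> \oo] --> f (a + x)].

Lemma expr_cvg0 (x : R) : 0 <= x < 1 -> x ^+ n @[n --> \oo] --> (0 : R).
Proof. by move=> /andP[x0 x1]; apply: cvg_expr; rewrite ger0_norm. Qed.

Lemma power_series_holo c r L f a : power_series c r L f a -> holomorphic_at f a.
Proof.
move=> [r0 _ cf]; exists c; apply/nbhs_md; exists r => // w /cf.
by rewrite [a + _]addrC subrK horner_truncE.
Qed.

(** The terms of a series convergent at radius e/2 are bounded, hence at radius
    e/4 they are dominated by a geometric series. *)
Lemma holo_power_series f a : holomorphic_at f a ->
  exists c r L, power_series c r L f a.
Proof.
move=> [u /nbhs_md[e e0 ue]].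
have e2 : 0 < e / 2 by rewrite divr_gt0.
have [M uM] : exists M, forall n, md (u n) * (e / 2) ^+ n <= M.
  have : md (a + ((e / 2)%:C)%C - a) < e.
    by rewrite addrAC subrr add0r md_real gtr0_norm // ltr_pdivrMr // ltr_pMr // ltr1n.
  move/ue; rewrite addrAC subrr add0r => cu.
  have : cvgn (series (fun n => u n * ((e / 2)%:C)%C ^+ n)) by apply/cvg_ex; eexists; exact: cu.
  move/cvg_series_cvg_0 => /cvg_md /(_ 1 ltr01) [N _ HN].
  exists (1 + \sum_(i < N) md (u i) * (e / 2) ^+ i) => n.
  have S0 : forall i : 'I_N, true -> 0 <= md (u i) * (e / 2) ^+ i.
    by move=> i _; rewrite mulr_ge0 ?md_ge0 ?exprn_ge0 ?ltW.
  have [nN|Nn] := ltnP n N.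
    rewrite (bigD1 (Ordinal nN)) //= addrCA ler_wpDr // addr_ge0 // sumr_ge0 // => i _.
    exact: S0.
  have := HN n Nn; rewrite /= subr0 mdM mdX md_real gtr0_norm // => /ltW h.
  by rewrite (le_trans h) // ler_wpDr // sumr_ge0.
exists u, (e / 4), (2 * M); split; first by rewrite divr_gt0.
  move=> n; rewrite wt_trunc.
  have M0 : 0 <= M by apply: le_trans (uM 0); rewrite mulr_ge0 ?md_ge0.
  have : \sum_(i < n) md (u i) * (e / 4) ^+ i <= 2 * M - M / 2 ^+ n * 2.
    elim: n => [|n IH]; first by rewrite big_ord0 expr0 divr1 mulrC subrr.
    rewrite big_ord_recr /=; apply: (le_trans (lerD IH (lexx _))).
    have h : md (u n) * (e / 4) ^+ n <= M / 2 ^+ n.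
      have -> : e / 4 = (e / 2) / 2 by field.
      by rewrite [(e / 2 / 2) ^+ n]exprMn exprVn mulrA ler_pM2r ?invr_gt0 ?exprn_gt0.
    apply: (le_trans (lerD (lexx _) h)); rewrite le_eqVlt; apply/orP; left.
    apply/eqP; rewrite exprS; field; by rewrite expf_neq0.
  move/le_trans; apply; rewrite lerBlDr lerDl mulr_ge0 // divr_ge0 // exprn_ge0 //.
move=> x xe; have : md (a + x - a) < e.
  rewrite addrAC subrr add0r (lt_le_trans xe) // ler_pdivrMr // ler_pMr // ler1n //.
move/ue; rewrite addrAC subrr add0r; by rewrite horner_truncE.
Qed.

Lemma power_series_shrink c r L f a s : power_series c r L f a -> 0 < s -> s <= r ->
  power_series c s L f a.
Proof.
move=> [r0 cL cf] s0 sr; split => // [n|x xs]; first by rewrite (le_trans _ (cL n)) // wt_mono // ltW.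
by apply: cf; exact: lt_le_trans xs sr.
Qed.

Lemma power_series0 c r L f a : power_series c r L f a -> f a = c 0.
Proof.
move=> [r0 _ /(_ 0)]; rewrite md0 addr0 => /(_ r0) h.
have h' : (trunc c n).[0] @[n --> \oo] --> c 0.
  apply: cvg_near_cst; near=> n; rewrite horner_coef0 coef_trunc ifT //.
  by near: n; exists 1.
exact: (cvg_unique (@norm_hausdorff C C) h h').
Unshelve. all: by end_near. Qed.

(** By the estimate of tails, P n and the n-th truncation of the series of limit
    coefficients have the same limit. Products, composites and inverses are
    obtained in this way, from the same operations on truncations. *)
Lemma holo_criterion (P : nat -> {poly C}) r L f a :
  0 < r -> (forall n, wt r (P n) <= L) ->
  (forall m n, (m <= n)%N -> eqm m (P n) (P m)) ->
  (forall x, md x < r -> (P n).[x] @[n --> \oo] --> f (a + x)) ->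
  holomorphic_at f a.
Proof.
move=> r0 PL Pst Pf; pose c n := (P n.+1)`_n.
have cP n : eqm n (trunc c n) (P n).
  by move=> i i_n; rewrite coef_trunc i_n /c (Pst _ _ i_n).
have cL n : wt r (trunc c n) <= L.
  rewrite wt_trunc (le_trans _ (PL n)) // (wtE r (leq_maxr n (size (P n)))).
  rewrite (big_ord_widen _ (fun i => md (c i) * r ^+ i) (leq_maxl n (size (P n)))).
  rewrite big_mkcond; apply: ler_sum => i _; case: ifP => [i_n|_].
    by rewrite -(cP n i i_n) coef_trunc i_n.
  by rewrite mulr_ge0 ?md_ge0 ?exprn_ge0 ?ltW.
apply: (@power_series_holo c r L); split => // x xr.
have h : (trunc c n).[x] - (P n).[x] @[n --> \oo] --> (0 : C).
  apply: (@cvg_md_le _ _ _ _ _ _ (fun n => (md x / r) ^+ n * (L + L))).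
    apply: nearW => n; rewrite subr0.
    apply: (le_trans (eqm_horner r0 (@cP n) (ltW xr))).
    by rewrite ler_wpM2l ?exprn_ge0 ?divr_ge0 ?md_ge0 ?(ltW r0) // lerD.
  rewrite -[X in _ --> X](mul0r (L + L)); apply: cvgM; last exact: cvg_cst.
  by apply: expr_cvg0; rewrite divr_ge0 ?md_ge0 ?(ltW r0) //= ltr_pdivrMr // mul1r.
rewrite -[f _]add0r; apply: cvg_trans (cvgD h (Pf x xr)).
by apply: near_eq_cvg; apply: nearW => n /=; rewrite subrK.
Qed.

Lemma holo_eq f g a : f =1 g -> holomorphic_at f a -> holomorphic_at g a.
Proof. by move=> /funext ->. Qed.

Lemma holo_near f g a : (\forall w \near a, f w = g w) ->
  holomorphic_at f a -> holomorphic_at g a.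
Proof. by move=> fg [u H]; exists u; by apply: (@filterS2 _ (nbhs a) _ _ _ _ _ fg H) => w ->. Qed.

Lemma holo_cst (k : C) a : holomorphic_at (fun=> k) a.
Proof.
apply: (@holo_criterion (fun n => if n is 0 then 0 else k%:P) 1 (md k)) => //.
- case=> [|n]; first by rewrite wt0 md_ge0.
  by rewrite -[k%:P]add0r -[0](mul0r 'X) wt_cons wt0 mul0r add0r.
- by case=> [|m] [|n].
- move=> x _; apply: cvg_near_cst; exists 1 => // -[//|n _]; by rewrite hornerC.
Qed.

Lemma holo_id a : holomorphic_at id a.
Proof.
pose c i : C := if i is 0 then a else if i is 1 then 1 else 0.
have cE n : trunc c n.+2 = 'X + a%:P.
  by apply/polyP => -[|[|i]]; rewrite coef_trunc coefD coefX coefC /= ?add0r ?addr0 //; case: ifP.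
exists c; apply: (@filterE _ (nbhs a)) => w; apply: cvg_near_cst; exists 2 => // -[|[|n]] //= _.
by rewrite -horner_trunc cE hornerD hornerX hornerC subrK.
Qed.

Lemma holoM f g a : holomorphic_at f a -> holomorphic_at g a ->
  holomorphic_at (fun w => f w * g w) a.
Proof.
move=> /holo_power_series[c [r [L cf]]] /holo_power_series[d [s [M dg]]].
have rs0 : 0 < Num.min r s by rewrite lt_min; case: cf dg => ? _ _ [? _ _]; apply/andP.
have [rmin smin] : Num.min r s <= r /\ Num.min r s <= s by rewrite !ge_min !lexx orbT.
have [_ cL cf'] := power_series_shrink cf rs0 rmin.
have [_ dM dg'] := power_series_shrink dg rs0 smin.
apply: (@holo_criterion (fun n => trunc c n * trunc d n) (Num.min r s) (L * M) _ a rs0).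
- move=> n; apply: (le_trans (wtM _ _ (ltW rs0))).
  by apply: ler_pM => //; apply: wt_ge0; exact: ltW.
- by move=> m n mn; apply: eqmM; exact: eqm_trunc.
- move=> x xr; under eq_fun do rewrite hornerM.
  by apply: cvgM; [exact: cf'|exact: dg'].
Qed.

Lemma holoD f g a : holomorphic_at f a -> holomorphic_at g a ->
  holomorphic_at (fun w => f w + g w) a.
Proof.
move=> [u fu] [v gv]; exists (fun n => u n + v n); near=> w.
have -> : series (fun n => (u n + v n) * (w - a) ^+ n) =
   series (fun n => u n * (w - a) ^+ n) + series (fun n => v n * (w - a) ^+ n).
  by rewrite -seriesD; congr series; apply/funext => n; exact: mulrDl.
by apply: cvgD; [exact: (near fu)|exact: (near gv)].
Unshelve. all: by end_near. Qed.

Lemma holoN f a : holomorphic_at f a -> holomorphic_at (fun w => - f w) a.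
Proof.
move=> hf; have := holoM (holo_cst (-1) a) hf.
by apply: holo_eq => w; exact: mulN1r.
Qed.

Lemma holoB f g a : holomorphic_at f a -> holomorphic_at g a ->
  holomorphic_at (fun w => f w - g w) a.
Proof. by move=> hf hg; exact: (holoD hf (holoN hg)). Qed.

Lemma holoX f a n : holomorphic_at f a -> holomorphic_at (fun w => f w ^+ n) a.
Proof.
move=> hf; elim: n => [|n IH].
  by apply: holo_eq (holo_cst 1 a) => w; rewrite expr0.
by apply: holo_eq (holoM hf IH) => w; rewrite exprS.
Qed.

(** With f centred to f(a) = 0, the n-jet of g o f only depends on the n-jets of
    g and f, so the composites of the truncations satisfy the criterion, once
    the radius is so small that f maps the disc into half the disc of g. *)
Lemma holo_comp f g a : holomorphic_at f a -> holomorphic_at g (f a) ->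
  holomorphic_at (g \o f) a.
Proof.
move=> hf /holo_power_series[d [s [M [s0 dM dg]]]].
have /holo_power_series[c [r [L cf]]] : holomorphic_at (fun w => f w - f a) a.
  exact: (holoB hf (holo_cst _ _)).
have c0 : c 0%N = 0 by rewrite -(power_series0 cf) subrr.
have [r0 cL _] := cf.
have L0 : 0 <= L by rewrite (le_trans _ (cL 0)) // wt_ge0 // ltW.
have [r' [r'0 r'r Lr']] : exists r', [/\ 0 < r', r' <= r & r' * L <= s / 4 * r].
  exists (r * (s / (s + 4 * L))); have h : 0 < s + 4 * L by rewrite ltr_pwDl // mulr_ge0.
  split; first by rewrite mulr_gt0 // divr_gt0.
    by rewrite ger_pMr // ler_pdivrMr // mul1r lerDl mulr_ge0.
  have -> : r * (s / (s + 4 * L)) * L = (s / 4 * r) * ((4 * L) / (s + 4 * L)) by field; rewrite gt_eqF.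
  rewrite ger_pMr ?mulr_gt0 ?divr_gt0 // ler_pdivrMr // mul1r lerDr ltW //.
have [_ _ cf'] := power_series_shrink cf r'0 r'r.
have cs n : wt r' (trunc c n) <= s / 4.
  have := wt_shrink (ltW r'0) r'r (_ : (trunc c n)`_0 = 0).
  rewrite coef_trunc c0 if_same => /(_ erefl) h.
  rewrite -(ler_pM2r r0) (le_trans h) // (le_trans _ Lr') // ler_pM2l //.
apply: (@holo_criterion (fun n => trunc d n \Po trunc c n) r' M _ a r'0).
- move=> n; apply: (le_trans (wt_comp _ (ltW r'0) (cs n))).
  apply: le_trans (dM n); apply: wt_mono; first by rewrite divr_ge0 // ltW.
  by rewrite ler_pdivrMr // ler_pMr // ler1n.
- move=> m n mn; apply: eqm_comp; [by rewrite coef_trunc c0 if_same|exact: eqm_trunc..].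
move=> x xr; set y := f (a + x) - f a.
have cy : (trunc c n).[x] @[n --> \oo] --> y by exact: cf'.
have ys : md y <= s / 2.
  rewrite leNgt; apply/negP => ys.
  have e0 : 0 < s / 4 by rewrite divr_gt0.
  move/cvg_md: cy => /(_ _ e0)[N _ /(_ N (leqnn _))] /=.
  apply/negP; rewrite -leNgt mdB.
  have h1 := le_trans (wt_horner (trunc c N) (ltW xr)) (cs N).
  have h2 : md y <= md (y - (trunc c N).[x]) + md (trunc c N).[x].
    by rewrite (le_trans _ (mdD _ _)) // subrK.
  lra.
have dy : (trunc d n).[y] @[n --> \oo] --> g (f (a + x)).
  have -> : f (a + x) = f a + y by rewrite /y [RHS]addrC subrK.
  by apply: dg; rewrite (le_lt_trans ys) // ltr_pdivrMr // ltr_pMr // ltr1n.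
have h : (trunc d n).[(trunc c n).[x]] - (trunc d n).[y] @[n --> \oo] --> (0 : C).
  apply: (@cvg_md_le _ _ _ _ _ _ (fun n => md ((trunc c n).[x] - y) * (M / s))).
    apply: nearW => n; rewrite subr0 mulrA ler_pdivlMr //.
    apply: (le_trans (horner_lip _ s0 _ _)) => //.
      rewrite (le_trans (wt_horner _ (ltW xr))) // (le_trans (cs n)) //.
      by rewrite ler_pM2l // lef_pV2 ?posrE // ler_nat.
    by rewrite ler_wpM2l ?md_ge0.
  rewrite -[X in _ --> X](mul0r (M / s)); apply: cvgM; last exact: cvg_cst.
  apply/cvgrPdist_lt => e e0; move/cvg_md: cy => /(_ _ e0).
  by apply: filterS => n; rewrite sub0r normrN ger0_norm ?md_ge0.
rewrite /= -[g _]add0r; apply: cvg_trans (cvgD h dy).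
by apply: near_eq_cvg; apply: nearW => n /=; rewrite subrK horner_comp.
Qed.

(** The Lipschitz bound for the truncations passes to the limit; continuity
    thus holds on a whole neighbourhood of the centre. *)
Lemma holo_continuous f a : holomorphic_at f a ->
  \forall w \near a, {for w, continuous f}.
Proof.
move=> /holo_power_series[c [r [L [r0 cL cf]]]].
have r2 : 0 < r / 2 by rewrite divr_gt0.
have lip x y : md x < r / 2 -> md y < r / 2 ->
    md (f (a + x) - f (a + y)) <= md (x - y) * (L / r).
  move=> xr yr; have r2r : r / 2 < r by rewrite ltr_pdivrMr // ltr_pMr // ltr1n.
  rewrite leNgt; apply/negP; rewrite -subr_gt0 => e0.
  have /cvg_md /(_ _ e0) [N _ /(_ N (leqnn _))] :
      (trunc c n).[x] - (trunc c n).[y] @[n --> \oo] --> f (a + x) - f (a + y).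
    by apply: cvgB; apply: cf; [exact: lt_trans xr r2r|exact: lt_trans yr r2r].
  rewrite /= mdB; apply/negP; rewrite -leNgt lerBlDr.
  have h : md ((trunc c N).[x] - (trunc c N).[y]) <= md (x - y) * (L / r).
    rewrite mulrA ler_pdivlMr //; apply: (le_trans (horner_lip _ r0 (ltW xr) (ltW yr))).
    by rewrite ler_wpM2l ?md_ge0.
  set u := f (a + x) - f (a + y); set v := (trunc c N).[x] - (trunc c N).[y] in h *.
  have -> : md u = md ((u - v) + v) by rewrite subrK.
  by rewrite (le_trans (mdD _ _)) // lerD2l.
apply/nbhs_md; exists (r / 2) => // w wr.
apply/(@cvg_md _ _ (nbhs w) _ f) => e e0.
have L0 : 0 <= L by rewrite (le_trans _ (cL 0)) // wt_ge0 // ltW.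
have L1 : 0 < L / r + 1 by rewrite ltr_wpDl // divr_ge0 // ltW.
have d0 : 0 < Num.min (r / 2 - md (w - a)) (e / (L / r + 1)).
  by rewrite lt_min subr_gt0 wr divr_gt0.
apply/nbhs_md; exists (Num.min (r / 2 - md (w - a)) (e / (L / r + 1))) => //.
move=> v; rewrite lt_min => /andP[v1 v2].
have vr : md (v - a) < r / 2.
  have -> : v - a = (v - w) + (w - a) by ring.
  by rewrite (le_lt_trans (mdD _ _)) // -ltrBrDr.
have := lip _ _ vr wr; rewrite ![a + _]addrC !subrK => /le_lt_trans; apply.
have -> : v - a - (w - a) = v - w by ring.
move: v2; rewrite ltr_pdivlMr //; apply: le_lt_trans.
by rewrite ler_wpM2l ?md_ge0 // lerDl.
Qed.

Lemma holo_continuous_at f a : holomorphic_at f a -> {for a, continuous f}.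
Proof. by move/holo_continuous/nbhs_singleton. Qed.

End analytic.

(** * Zeros, inverses and the binomial series *)

Section zeros_and_inverses.
Variable R : realType.
Local Notation C := (cplx R).
Implicit Types (c : nat -> C) (p q : {poly C}) (r : R) (f g : C -> C) (a : C).

(** Absolute convergence implies convergence in C: apply completeness of R to the
    real and imaginary parts. *)
Lemma cvgn_norm_summable (u : nat -> C) (M : R) :
  (forall n, \sum_(i < n) md (u i) <= M) -> cvgn (series u).
Proof.
move=> uM.
have part (h : C -> R) : (forall x, `|h x| <= md x) -> cvgn (series (h \o u)).
  move=> hm; apply: normed_cvg; apply: nondecreasing_is_cvgn.
    by apply: nondecreasing_series => n _ _; exact: normr_ge0.
  exists M => _ [n _ <-]; apply: le_trans (uM n).
  by rewrite /normed_series_of /series /= big_mkord; apply: ler_sum => i _; exact: hm.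
have /cvg_ex[x ux] := part _ (fun x => (Re_Im_le_md x).1).
have /cvg_ex[y uy] := part _ (fun x => (Re_Im_le_md x).2).
apply/cvg_ex; exists (x +i* y)%C; apply/cvg_md => e e0.
have e2 : 0 < e / 2 by rewrite divr_gt0.
move/cvgrPdist_lt: ux => /(_ _ e2) ux; move/cvgrPdist_lt: uy => /(_ _ e2) uy.
near=> n.
have xn : `|x - complex.Re (series u n)| < e / 2.
  by rewrite /series /= raddf_sum; near: n.
have yn : `|y - complex.Im (series u n)| < e / 2.
  by rewrite /series /= raddf_sum; near: n.
have -> : series u n - (x +i* y)%C =
    ((complex.Re (series u n) - x)%:C + (0 +i* 1) * (complex.Im (series u n) - y)%:C)%C.
  by case: (series u n) => s t /=; simpc.
rewrite (le_lt_trans (mdD _ _)) // mdM !md_real.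
by rewrite md_i mul1r [e]splitr ltrD // distrC.
Unshelve. all: by end_near. Qed.

Lemma sum_half_le n : \sum_(i < n) (2^-1 : R) ^+ i <= 2.
Proof.
suff -> : \sum_(i < n) (2^-1 : R) ^+ i = 2 - 2 * 2^-1 ^+ n.
  by rewrite lerBlDr lerDl mulr_ge0 // exprn_ge0 // invr_ge0.
elim: n => [|n IH]; first by rewrite big_ord0 expr0 mulr1 subrr.
by rewrite big_ord_recr /= IH exprS; field.
Qed.

Lemma trunc_recr c n : trunc c n.+1 = trunc c n + c n *: 'X^n.
Proof.
apply/polyP => i; rewrite coefD coefZ coefXn !coef_trunc ltnS leq_eqVlt.
by case: eqVneq => [->|_] /=; rewrite ?ltnn ?mulr1 ?mulr0 ?add0r ?addr0.
Qed.

(** The order m is the index of the first nonzero Taylor coefficient; shifting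
    the coefficients by m gives u. *)
Lemma holo_factor f a : holomorphic_at f a ->
  (\forall w \near a, f w = 0) \/
  exists m u, [/\ holomorphic_at u a, u a != 0 &
    \forall w \near a, f w = (w - a) ^+ m * u w].
Proof.
move=> /holo_power_series[c [r [L cf]]]; have [r0 cL cvf] := cf.
have [c0|] := pselect (forall n, c n = 0).
  left; apply/nbhs_md; exists r => // w wr; have := cvf _ wr.
  rewrite [a + _]addrC subrK => h.
  have t0 : (trunc c n).[w - a] @[n --> \oo] --> (0 : C).
    apply: cvg_near_cst; exists 0 => // n _ /=.
    rewrite (_ : trunc c n = 0) ?horner0 //; apply/polyP => i.
    by rewrite coef_trunc coef0 c0 if_same.
  exact: (cvg_unique (@norm_hausdorff C C) h t0).
move=> /existsNP[n0 /eqP n0P]; right.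
have [m mP mmin] := ex_minnP (ex_intro (fun n => c n != 0) n0 n0P).
pose d n := c (n + m)%N.
have cd n : trunc c (n + m) = trunc d n * 'X^m.
  apply/polyP => i; rewrite coefMXn !coef_trunc; case: (ltnP i m) => im.
    have [ci|//] := eqVneq (c i) 0; first by rewrite ci if_same.
    by move/mmin; rewrite leqNgt im.
  by rewrite /d subnK // ltn_subLR // addnC.
have h x n : (trunc c (n + m)).[x] = (trunc d n).[x] * x ^+ m.
  by rewrite cd hornerM hornerXn.
pose u w := if w == a then c m else f w / (w - a) ^+ m.
have du : power_series d r (L / r ^+ m) u a.
  split=> [|n|x xr]; first exact: r0.
    rewrite ler_pdivlMr ?exprn_gt0 //; apply: le_trans (cL (m + n)%N).
    rewrite !wt_trunc big_split_ord /= mulr_suml ler_wpDl //.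
      by apply: sumr_ge0 => i _; rewrite mulr_ge0 ?md_ge0 ?exprn_ge0 ?(ltW r0).
    by apply: ler_sum => i _; rewrite /d addnC exprD mulrCA mulrC.
  have [->|x0] := eqVneq x 0.
    rewrite /u addr0 eqxx; apply: cvg_near_cst; exists 1 => // -[//|n] _ /=.
    by rewrite horner_coef0 coef_trunc.
  rewrite /u [a + x]addrC; have -> : (x + a == a) = false.
    by apply/negbTE; rewrite -subr_eq0 addrK.
  rewrite addrK; have := cvf _ xr.
  rewrite -(cvg_shiftn m) /= => hc.
  have -> : (fun n => (trunc d n).[x]) = (fun n => (trunc c (n + m)).[x] / x ^+ m).
    by apply/funext => n; rewrite h mulfK ?expf_neq0.
  by rewrite [x + a]addrC; apply: (cvgM hc); exact: cvg_cst.
exists m, u; split; first exact: power_series_holo du.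
  by rewrite /u eqxx.
apply/nbhs_md; exists r => // w wr; rewrite /u; case: eqVneq => [->|wa]; last first.
  by rewrite mulrCA divff ?mulr1 // expf_neq0 // subr_eq0.
have [m0|m0] := posnP m; last by rewrite subrr expr0n gtn_eqF // mul0r (power_series0 cf);
  have [//|/mmin] := eqVneq (c 0%N) 0; rewrite leqNgt m0.
by rewrite m0 expr0 mul1r (power_series0 cf).
Qed.

(** The geometric series 1/(b + x) = sum (-x)^i / b^(i+1). *)
Lemma holo_inv_id (b : C) : b != 0 -> holomorphic_at (fun w => w^-1) b.
Proof.
move=> b0; have mb0 : 0 < md b by rewrite md_gt0.
pose c i := b^-1 * (- b^-1) ^+ i.
have cE n x : (trunc c n).[x] * (b + x) = 1 - (- (x / b)) ^+ n.
  elim: n => [|n IH]; first by rewrite /trunc poly_def big_ord0 horner0 mul0r expr0 subrr.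
  rewrite trunc_recr hornerD mulrDl IH hornerZ hornerXn /c exprS.
  have -> : - (x / b) = x * - b^-1 by rewrite mulrN.
  by rewrite exprMn; field.
apply: (@holo_criterion _ (trunc c) (md b / 2) (2 / md b) _ b); first by rewrite divr_gt0.
- move=> n; rewrite wt_trunc.
  have -> : \sum_(i < n) md (c i) * (md b / 2) ^+ i = (\sum_(i < n) 2^-1 ^+ i) / md b.
    rewrite mulr_suml; apply: eq_bigr => i _.
    rewrite /c mdM mdV mdX mdN mdV exprMn -!mulrA [RHS]mulrC; congr (_ * _).
    by rewrite mulrA -exprMn mulVf ?gt_eqF // expr1n mul1r.
  by rewrite ler_wpM2r ?invr_ge0 ?md_ge0 // sum_half_le.
- by move=> m n mn; exact: eqm_trunc.
move=> x xb.
have xb0 : b + x != 0.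
  apply/eqP => /addr0_eq xE; move: xb; rewrite -xE mdN.
  move=> h; lra.
have -> : (fun n => (trunc c n).[x]) = (fun n => (1 - (- (x / b)) ^+ n) * (b + x)^-1).
  by apply/funext => n; rewrite -cE mulfK.
rewrite -[X in _ --> X]mul1r; apply: cvgM; last exact: cvg_cst.
rewrite -[X in _ --> X]subr0; apply: cvgB; first exact: cvg_cst.
apply: (@cvg_md_le _ _ _ _ _ _ (fun n => (md x / md b) ^+ n)).
  by apply: nearW => n; rewrite subr0 mdX mdN mdM mdV.
apply: expr_cvg0; rewrite divr_ge0 ?md_ge0 //= ltr_pdivrMr // mul1r (lt_le_trans xb) //; lra.
Qed.

Lemma holoV f a : f a != 0 -> holomorphic_at f a ->
  holomorphic_at (fun w => (f w)^-1) a.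
Proof. by move=> fa0 hf; exact: (holo_comp hf (holo_inv_id fa0)). Qed.

(** Coefficients of the binomial series (1 + x)^(1/k). *)
Fixpoint root_coef (k n : nat) : C :=
  if n is n'.+1 then root_coef k n' * (k%:R^-1 - n'%:R) / n'.+1%:R else 1.

Lemma root_coef_le1 k n : (0 < k)%N -> md (root_coef k n) <= 1.
Proof.
move=> k0; elim: n => [|n IH]; first by rewrite md1.
rewrite /= -mulrA mdM mulr_ile1 ?md_ge0 //.
have mdn (i : nat) : md (i%:R : C) = i%:R.
  have -> : md (i%:R : C) = md ((i%:R : R)%:C)%C by congr (md _); exact: (esym (rmorph_nat (real_complex R) i)).
  by rewrite md_real ger0_norm.
rewrite mdM mdV mdn ler_pdivrMr ?ltr0n // mul1r (le_trans (mdD _ _)) //.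
by rewrite mdN mdV !mdn -natr1 addrC lerD2l invf_le1 ?ler1n ?ltr0n.
Qed.

(** The binomial series solves (1 + X) B' = B / k, so its k-th power E solves
    (1 + X) E' = E with E(0) = 1, hence is 1 + X. *)
Lemma root_coef_pow k n : (0 < k)%N ->
  eqm n.+1 (trunc (root_coef k) n.+1 ^+ k) ('X + 1).
Proof.
move=> k0; set B := trunc _ _; have kn0 : k%:R != 0 :> C by rewrite pnatr_eq0 -lt0n.
have B0 : B.[0] = 1 by rewrite horner_coef0 coef_trunc.
have dB : exists s, ('X + 1) * B^`() = k%:R^-1 *: B + s * 'X^n.
  apply/eqmP => i i_n; rewrite mulrDl mul1r mulrC coefD coefMX coefZ !coef_deriv !coef_trunc.
  have -> : (i.+1 < n.+1)%N by [].
  have -> : (i < n.+1)%N by rewrite ltnS ltnW.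
  case: i i_n => [|i] i_n /=; first by rewrite add0r !mul1r subr0 divr1 mulr1.
  have -> : (i.+1 < n.+1)%N by rewrite ltnW.
  rewrite -[_ *+ i.+1]mulr_natr -[_ *+ i.+2]mulr_natr; field.
  by rewrite kn0 -(natrD _ 1 i) -(natrD _ 2 i) !pnatr_eq0.
have [s dBE] := dB; pose E := B ^+ k.
have dE : exists t, ('X + 1) * E^`() = E + t * 'X^n.
  exists (s * B ^+ k.-1 * k%:R).
  have -> : E = B * B ^+ k.-1 by rewrite -exprS prednK.
  have -> : (B * B ^+ k.-1)^`() = (B ^+ k)^`() by rewrite -exprS prednK.
  rewrite deriv_exp -[_ *+ k]mulr_natr !mulrA dBE.
  have kk : (k%:R^-1)%:P * k%:R = 1 :> {poly C}.
    by rewrite -polyC_natr -polyCM mulVf.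
  rewrite -mul_polyC; move: (k%:R^-1)%:P (k%:R : {poly C}) (B ^+ _) kk => u v b kk.
  rewrite !mulrDl; congr (_ + _); last by ring.
  rewrite -[RHS]mul1r -kk; ring.
have E0 : E`_0 = 1 by rewrite -horner_coef0 horner_exp B0 expr1n.
have Erec i : (i < n)%N -> E`_i.+1 *+ i.+1 + E`_i *+ i = E`_i.
  move=> i_n; case: dE => t /(congr1 (fun p : {poly C} => p`_i)).
  rewrite mulrDl mul1r mulrC !coefD coefMX coefMXn i_n addr0 => h; rewrite -[RHS]h addrC !coef_deriv.
  by case: i {i_n h} => [|i] //=; rewrite ?mulr0n.
have E2 : forall i, (i.+1 < n)%N -> E`_i.+2 = 0.
  elim=> [|i IH] i_n; have := Erec _ i_n.
    by rewrite mulr1n => /eqP; rewrite -subr_eq0 addrK mulrn_eq0 /= => /eqP.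
  by rewrite (IH (ltnW i_n)) mul0rn addr0 => /eqP; rewrite mulrn_eq0 /= => /eqP.
case=> [_|[i1|i i_n]]; rewrite -/B -/E coefD coefX coef1 /= ?add0r ?addr0 //.
  by have := Erec 0%N i1; rewrite mulr1n mulr0n addr0 E0.
exact: E2.
Qed.

End zeros_and_inverses.

(** * Holomorphic roots, punctured discs and roots of unity *)

Section holomorphic_roots.
Variable R : realType.
Local Notation C := (cplx R).
Implicit Types (c : nat -> C) (r : R) (f g : C -> C) (a : C).

(** The binomial series with exponent 1/k converges, being bounded in weight on
    the disc of radius 1/2, and its k-th power is 1 + x by comparison of jets. *)
Lemma holo_root1 k : (0 < k)%N ->
  exists v : C -> C, holomorphic_at v 1 /\ \forall w \near (1 : C), v w ^+ k = w.
Proof.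
move=> k0; pose c := @root_coef R k.
have r0 : 0 < 2^-1 :> R by rewrite invr_gt0.
have wtc n : wt (2^-1 : R) (trunc c n) <= 2.
  rewrite wt_trunc (le_trans _ (sum_half_le R n)) //; apply: ler_sum => i _.
  by rewrite ler_piMl ?exprn_ge0 ?(ltW r0) // root_coef_le1.
pose s x := series (fun i => c i * x ^+ i).
have cv (x : C) : md x < 2^-1 -> cvgn (s x).
  move=> xr; apply: (@cvgn_norm_summable _ _ 2) => n.
  rewrite (le_trans _ (wtc n)) // wt_trunc; apply: ler_sum => i _.
  by rewrite mdM mdX ler_wpM2l ?md_ge0 // lerXn2r ?nnegrE ?md_ge0 ?(ltW r0) ?(ltW xr).
pose v w := limn (s (w - 1)).
have vE (x : C) : md x < 2^-1 -> (trunc c n).[x] @[n --> \oo] --> v (1 + x).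
  move=> xr; rewrite horner_truncE.
  have -> : v (1 + x) = limn (s x) by rewrite /v addrAC subrr add0r.
  exact: cv xr.
exists v; split.
  apply: (@power_series_holo _ c (2^-1) 2 v 1); split=> [|n|x xr]; [exact: r0|exact: wtc|exact: vE].
apply/nbhs_md; exists (2^-1) => // w wr.
have hk : (trunc c n.+1).[w - 1] ^+ k @[n --> \oo] --> v w ^+ k.
  have h := vE _ wr; rewrite [1 + _]addrC subrK in h.
  move: h; rewrite -(cvg_shiftS) /= => h.
  exact: (continuous_cvg _ (holo_continuous_at (holoX k (holo_id (v w)))) h).
have hw : (trunc c n.+1).[w - 1] ^+ k @[n --> \oo] --> w.
  apply: (@cvg_md_le _ _ _ _ _ _ (fun n => (md (w - 1) / 2^-1) ^+ n.+1 * (2 ^+ k + wt 2^-1 ('X + 1 : {poly C})))).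
    apply: nearW => n; have := eqm_horner r0 (@root_coef_pow R k n k0) (ltW wr).
    rewrite hornerD hornerX hornerC subrK horner_exp => /le_trans; apply.
    rewrite ler_wpM2l ?exprn_ge0 ?divr_ge0 ?md_ge0 ?(ltW r0) // lerD2r.
    apply: (le_trans (wtX _ _ (ltW r0))); rewrite lerXn2r ?nnegrE //; exact: wt_ge0 (ltW r0).
  rewrite -[X in _ --> X](mul0r (2 ^+ k + wt 2^-1 ('X + 1 : {poly C}))).
  apply: cvgM; last exact: cvg_cst.
  rewrite (cvg_shiftS (fun n => (md (w - 1) / 2^-1) ^+ n)).
  by apply: expr_cvg0; rewrite divr_ge0 ?md_ge0 ?(ltW r0) //= ltr_pdivrMr // mul1r.
exact: (cvg_unique (@norm_hausdorff C C) hk hw).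
Qed.

(** Near a the quotient u / u(a) is close to 1: compose it with the binomial
    series, and multiply by a k-th root of the number u(a). *)
Lemma holo_root u a k : (0 < k)%N -> holomorphic_at u a -> u a != 0 ->
  exists v, [/\ holomorphic_at v a, v a != 0 & \forall w \near a, v w ^+ k = u w].
Proof.
move=> k0 hu ua0; have [v1 [hv1 v1k]] := holo_root1 k0.
pose b := k.-root (u a).
have hb : b ^+ k = u a by rewrite rootCK.
have hq : holomorphic_at (fun w => u w * (u a)^-1) a := holoM hu (holo_cst _ _).
have qa : u a * (u a)^-1 = 1 by rewrite mulfV.
pose v w := b * v1 (u w * (u a)^-1).
have vk : \forall w \near a, v w ^+ k = u w.
  have : \forall w \near (u a * (u a)^-1), v1 w ^+ k = w by rewrite qa.
  move/(holo_continuous_at hq); apply: (@filterS _ (nbhs a)) => w /= H.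
  by rewrite /v exprMn H hb mulrCA mulfV // mulr1.
have va0 : v a != 0.
  have /= := nbhs_singleton vk; apply: contra_eq_neq => ->.
  by rewrite expr0n gtn_eqF // eq_sym.
have hv : holomorphic_at v a.
  apply: (holoM (holo_cst b a)); apply: (holo_comp hq (g := v1)).
  by rewrite qa.
by exists v.
Qed.

Definition punctured_disc a r : set C := [set w | 0 < md (w - a) < r].

Lemma real_complex_continuous : continuous (fun t : R => ((t%:C)%C : C)).
Proof.
move=> t; apply/(@cvg_md _ _ (nbhs t) _ (fun t : R => ((t%:C)%C : C))) => e e0.
have /cvgrPdist_lt /(_ _ e0) : id @ t --> t by exact: cvg_id.
apply: (@filterS _ (nbhs t)) => s.
have -> : md ((s%:C)%C - (t%:C)%C : C) = `|s - t| by rewrite -(@md_real R) rmorphB.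
by rewrite distrC.
Qed.

Lemma cst_cplx_continuous (T : topologicalType) (k : C) : continuous (fun _ : T => k).
Proof. by move=> x; exact: cvg_cst. Qed.

Lemma segment_connectedC (p q : C) :
  connected [set p + (t%:C)%C * (q - p) | t in `[0, 1 : R]].
Proof.
apply: connected_continuous_connected; first exact: segment_connected.
apply: continuous_subspaceT => t.
apply: (@continuousD C C R (fun=> p)); first exact: cst_cplx_continuous.
by apply: continuousM; [exact: real_complex_continuous|exact: cst_cplx_continuous].
Qed.

Lemma connected_chain (T : topologicalType) (D : set T) :
  (forall p q, D p -> D q -> exists A, [/\ connected A, A p, A q & A `<=` D]) ->
  connected D.
Proof.
move=> H; have [->|/set0P[p Dp]] := eqVneq D set0; first exact: connected0.
suff -> : D = connected_component D p by exact: component_connected.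
apply/seteqP; split=> [q Dq|]; last exact: connected_component_sub.
have [A [cA Ap Aq AD]] := H _ _ Dp Dq.
exact: (connected_component_max Ap AD cA Aq).
Qed.

(** Two points are joined by the segment between them unless it passes through a;
    then the first point turned by a right angle around a sees both. *)
Lemma punctured_connected a r : connected (punctured_disc a r).
Proof.
apply: connected_chain => p q.
have seg p' q' : punctured_disc a r p' -> punctured_disc a r q' ->
    (forall t : R, 0 <= t <= 1 -> ((1 - t)%:C)%C * (p' - a) + (t%:C)%C * (q' - a) != 0) ->
  exists A, [/\ connected A, A p', A q' & A `<=` punctured_disc a r].
  move=> /andP[p0 pr] /andP[q0 qr] nz.
  exists [set p' + (t%:C)%C * (q' - p') | t in `[0, 1 : R]]; split.
  - exact: segment_connectedC.
  - by exists 0; rewrite ?mul0r ?addr0 //= in_itv /= lexx ler01.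
  - by exists 1; rewrite ?mul1r ?[p' + _]addrC ?subrK //= in_itv /= lexx ler01.
  move=> _ [t /= + <-]; rewrite in_itv /= => /[dup] /andP[t0 t1] /nz.
  rewrite /punctured_disc /= md_gt0.
  have -> : p' + (t%:C)%C * (q' - p') - a =
      ((1 - t)%:C)%C * (p' - a) + (t%:C)%C * (q' - a).
    by rewrite rmorphB rmorph1; ring.
  move=> ->; rewrite (le_lt_trans (mdD _ _)) // !mdM !md_real !ger0_norm ?subr_ge0 //.
  have : (1 - t) * md (p' - a) <= (1 - t) * Num.max (md (p' - a)) (md (q' - a)).
    by rewrite ler_wpM2l ?subr_ge0 // le_max lexx.
  have : t * md (q' - a) <= t * Num.max (md (p' - a)) (md (q' - a)).
    by rewrite ler_wpM2l // le_max lexx orbT.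
  have : Num.max (md (p' - a)) (md (q' - a)) < r by rewrite gt_max pr.
  lra.
move=> Dp Dq; have [pq|] := pselect (forall t : R, 0 <= t <= 1 ->
  ((1 - t)%:C)%C * (p - a) + (t%:C)%C * (q - a) != 0); first exact: seg.
(* p and q are on opposite sides of a *)
move=> /existsNP[t /not_implyP[/andP[t0 t1] /negP/negPn/eqP tE]].
move: Dp Dq => /[dup] Dp /andP[p0 pr] /[dup] Dq /andP[q0 qr].
have pa0 : p - a != 0 by rewrite -md_gt0.
have qa0 : q - a != 0 by rewrite -md_gt0.
pose s := a + (0 +i* 1 : C)%C * (p - a).
have sE : s - a = (0 +i* 1 : C)%C * (p - a) by rewrite /s addrAC subrr add0r.
have Ds : punctured_disc a r s by rewrite /punctured_disc /= sE mdM md_i mul1r p0.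
have [A [cA Ap As AD]] : exists A, [/\ connected A, A p, A s & A `<=` punctured_disc a r].
  apply: seg => // t' /andP[t'0 t'1]; rewrite sE mulrA -mulrDl mulf_eq0 (negbTE pa0) orbF.
  apply/eqP => /eqP; simpc; rewrite eq_complex /= => /andP[/eqP h1 /eqP h2]; lra.
have tp : t != 0.
  by apply: contraTneq p0 => t00; move: tE; rewrite t00 subr0 mul1r mul0r addr0 => ->; rewrite md0 ltxx.
have t1' : 1 - t != 0.
  apply: contraTneq q0 => t00; move: tE; rewrite t00 mul0r add0r.
  have -> : t = 1 by lra.
  by rewrite mul1r => ->; rewrite md0 ltxx.
have tC : (t%:C)%C != 0 :> C by rewrite -md_eq0 md_real normr_eq0.
have qE : q - a = (- ((1 - t) / t)%:C)%C * (p - a).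
  apply: (mulfI tC); rewrite -[LHS]subr0 -tE rmorphM fmorphV /=.
  by field.
have [B [cB Bs Bq BD]] : exists A, [/\ connected A, A s, A q & A `<=` punctured_disc a r].
  apply: seg => // t' /andP[t'0 t'1]; rewrite sE qE !mulrA -mulrDl mulf_eq0 (negbTE pa0) orbF.
  apply/eqP => /eqP; simpc; rewrite eq_complex /= => /andP[/eqP h1 /eqP h2].
  have t'E : t' = 1 by lra.
  move: h1; rewrite t'E mul1r => /eqP; rewrite oppr_eq0 mulf_eq0 invr_eq0 (negbTE tp) (negbTE t1') //.
exists (A `|` B); split; [|by left|by right|by rewrite subUset].
by apply: connectedU => //; exists s.
Qed.

Lemma finite_roots (p : {poly C}) : p != 0 -> finite_set [set x | p.[x] = 0].
Proof.
move=> p0; have [s ps] := closed_field_poly_normal p.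
apply: (@sub_finite_set _ _ [set` s]); last exact: finite_seq.
move=> x /= /eqP; rewrite -/(root p x) ps rootZ ?lead_coef_eq0 //.
by rewrite root_prod_XsubC.
Qed.

(** The polynomial X^n - 1 is separable, so it has n distinct roots. *)
Lemma prim_root_ex n : (0 < n)%N -> exists z : C, n.-primitive_root z.
Proof.
pose p : {poly C} := 'X^n - 1; have [r Dp] := closed_field_poly_normal p.
move=> n_gt0; rewrite (monicP _) ?monicXnsubC // scale1r in Dp.
have rn1: all n.-unity_root r by apply/allP=> z; rewrite -root_prod_XsubC -Dp.
have sz_r: (n < (size r).+1)%N.
  by rewrite -(size_prod_XsubC r id) -Dp size_XnsubC.
have [|z] := hasP (has_prim_root n_gt0 rn1 _ sz_r); last by exists z.
by rewrite -separable_prod_XsubC -Dp separable_Xn_sub_1 // pnatr_eq0 -lt0n.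
Qed.

Lemma connected_finite (T : topologicalType) (A : set T) x y :
  hausdorff_space T -> connected A -> finite_set A -> A x -> A y -> x = y.
Proof.
move=> hT cA fA Ax Ay; apply: contrapT => xy.
have aT : accessible_space T by exact: hausdorff_accessible.
have cl (B : set T) : finite_set B -> closed B := (accessible_finite_set_closed.1 aT B).
move/connectedP: cA => /(_ (fun b => if b then [set x] else A `\ x)); apply; split.
- by case; [exists x|exists y; split=> // /esym].
- by rewrite setUC setD1K.
have c1 := cl _ (finite_set1 x); have c2 := cl _ (finite_setD [set x] fA).
rewrite /separated -(closure_id _).1 // -(closure_id _).1 //.
by split; apply/seteqP; split=> // z [[_ zx]] /zx.
Qed.

(** The image is connected and made of finitely many roots of X^k - 1. *)
Lemma unity_constant (A : set C) (H : C -> C) k : (0 < k)%N -> connected A ->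
  (forall w, A w -> {for w, continuous H}) -> (forall w, A w -> H w ^+ k = 1) ->
  forall w w', A w -> A w' -> H w = H w'.
Proof.
move=> k0 cA cH Hk w w' Aw Aw'.
apply: (@connected_finite _ (H @` A)); [exact: (@norm_hausdorff C C)| |  |by exists w|by exists w'].
  apply: connected_continuous_connected => //; apply: continuous_in_subspaceT.
  by move=> x /set_mem /cH.
apply: (sub_finite_set _ (finite_roots (p := 'X^k - 1) _)).
  by move=> _ [x Ax <-] /=; rewrite hornerD hornerN hornerXn hornerC Hk // subrr.
by rewrite -size_poly_gt0 size_XnsubC.
Qed.

End holomorphic_roots.

(** * Continuous roots across a puncture *)

Section continuity.
Variables (R : realType) (T : topologicalType).
Local Notation C := (cplx R).
Implicit Types (f g : T -> C) (x : T).

Lemma holo_horner (p : {poly C}) (a : C) : holomorphic_at (fun w => p.[w]) a.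
Proof.
elim/poly_ind: p => [|p k IH].
  by apply: holo_eq (holo_cst 0 a) => w; rewrite horner0.
apply: holo_eq (holoD (holoM IH (holo_id a)) (holo_cst k a)) => w.
by rewrite hornerMXaddC.
Qed.

Lemma continuous_hornerC (p : {poly C}) f x :
  {for x, continuous f} -> {for x, continuous (fun y => p.[f y])}.
Proof.
move=> cf; apply: (@continuous_comp T C C f (fun w => p.[w])); first exact: cf.
exact: holo_continuous_at (holo_horner p (f x)).
Qed.

Lemma continuousD_at f g x : {for x, continuous f} -> {for x, continuous g} ->
  {for x, continuous (fun y => f y + g y)}.
Proof. by move=> cf cg; exact: (@continuousD C C T f g x cf cg). Qed.

Lemma continuousN_at f x : {for x, continuous f} -> {for x, continuous (fun y => - f y)}.
Proof. by move=> cf; exact: (@continuousN C C T f x cf). Qed.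

Lemma continuousM_at f g x : {for x, continuous f} -> {for x, continuous g} ->
  {for x, continuous (fun y => f y * g y)}.
Proof. by move=> hf hg; exact: (@cvgM _ T (nbhs x) _ f g _ _ hf hg). Qed.

Lemma continuousV_at f x : f x != 0 -> {for x, continuous f} ->
  {for x, continuous (fun y => (f y)^-1)}.
Proof. by move=> f0 hf; exact: (@cvgV _ T (nbhs x) _ f _ f0 hf). Qed.

Lemma continuous_cst_at (k : C) x : {for x, continuous (fun _ : T => k)}.
Proof. exact: cst_cplx_continuous. Qed.

End continuity.

Section removable.
Variable R : realType.
Local Notation C := (cplx R).
Implicit Types (r : R) (f g u v F G : C -> C) (a : C).

Lemma cont_neq0 f a : {for a, continuous f} -> f a != 0 -> \forall w \near a, f w != 0.
Proof.
move=> /(@cvg_md _ _ (nbhs a) _ f) h; rewrite -md_gt0 => /h.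
apply: (@filterS _ (nbhs a)) => w; apply: contraTneq => ->.
by rewrite sub0r mdN ltxx.
Qed.

(** The monodromy argument. With v a holomorphic k-th root of u, the function F(a + s^k) / (v s^m) is a
    k-th root of unity, hence constant; its values at s and at y s, with y a
    primitive k-th root of unity, differ by y^m, so that k divides m. Then
    F / (v (w - a)^(m/k)) is constant as well. *)
Lemma root_removable F u a k m r : (0 < k)%N -> 0 < r ->
  holomorphic_at u a -> u a != 0 ->
  (forall w, punctured_disc a r w -> {for w, continuous F}) ->
  (forall w, punctured_disc a r w -> F w ^+ k = (w - a) ^+ m * u w) ->
  exists G, [/\ holomorphic_at G a, (0 < m)%N -> G a = 0 &
    \forall w \near a, w != a -> F w = G w].
Proof.
move=> k0 r0 hu ua0 cF Fk; have [v [hv va0 vk]] := holo_root k0 hu ua0.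
have : \forall w \near a, [/\ v w ^+ k = u w, v w != 0 & {for w, continuous v}].
  have h1 := cont_neq0 (holo_continuous_at hv) va0; have h2 := holo_continuous hv.
  by apply: (@filterS3 _ (nbhs a) _ _ _ _ _ _ vk h1 h2) => w ? ? ?; split.
move=> /nbhs_md[e e0 ve]; pose d := Num.min 1 (Num.min r e).
have d0 : 0 < d by rewrite !lt_min ltr01 r0 e0.
have [d1 dr de] : [/\ d <= 1, d <= r & d <= e] by rewrite /d !ge_min !lexx !orbT.
have Ddr w : punctured_disc a d w -> punctured_disc a r w.
  by move=> /andP[w0 wd]; rewrite /punctured_disc /= w0 (lt_le_trans wd).
have Dde w : punctured_disc a d w -> md (w - a) < e.
  by move=> /andP[w0 wd]; rewrite (lt_le_trans wd).
pose G1 w := F w * (v w)^-1.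
have cG1 w : punctured_disc a d w -> {for w, continuous G1}.
  move=> Dw; have [_ v0 cv] := ve _ (Dde _ Dw).
  exact: (continuousM_at (cF _ (Ddr _ Dw)) (continuousV_at v0 cv)).
have G1k w : punctured_disc a d w -> G1 w ^+ k = (w - a) ^+ m.
  move=> Dw; have [vw v0 _] := ve _ (Dde _ Dw).
  by rewrite /G1 exprMn exprVn vw Fk ?mulfK -?vw ?expf_neq0 //; exact: Ddr.
have D0 s : punctured_disc 0 d s -> punctured_disc a d (a + s ^+ k).
  rewrite /punctured_disc /= subr0 addrAC subrr add0r mdX => /andP[s0 sd].
  rewrite exprn_gt0 //= -(prednK k0) exprS (le_lt_trans _ sd) // ler_piMr ?md_ge0 //.
  by rewrite exprn_ile1 ?md_ge0 // ltW // (lt_le_trans sd).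
(* G1 w is a k-th root of (w - a)^m; pulled back by s |-> a + s^k *)
pose H s := G1 (a + s ^+ k) * (s ^+ m)^-1.
have s0P s : punctured_disc 0 d s -> s != 0.
  by rewrite /punctured_disc /= subr0 => /andP[]; rewrite md_gt0.
have hsk s : holomorphic_at (fun s => a + s ^+ k) s.
  exact: (holoD (holo_cst a s) (holoX k (holo_id s))).
have cH s : punctured_disc 0 d s -> {for s, continuous H}.
  move=> Ds; apply: continuousM_at.
    apply: (@continuous_comp C C C (fun s => a + s ^+ k) G1 s).
      exact: holo_continuous_at (hsk s).
    exact: cG1 (D0 _ Ds).
  apply: (@continuousV_at R C (fun s => s ^+ m)); first by rewrite expf_neq0 // s0P.
  exact: holo_continuous_at (holoX m (holo_id s)).
have Hk s : punctured_disc 0 d s -> H s ^+ k = 1.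
  move=> Ds; rewrite /H exprMn (G1k _ (D0 _ Ds)) addrAC subrr add0r exprVn -!exprM.
  by rewrite mulnC divff // expf_neq0 // s0P.
have km : (k %| m)%N.
  have [y yk] := prim_root_ex R k0.
  have my : md y = 1.
    have : md y ^+ k = 1 by rewrite -mdX prim_expr_order // md1.
    by move/eqP; rewrite pexpr_eq1 ?md_ge0 // => /eqP.
  have d2 : 0 < d / 2 by rewrite divr_gt0.
  pose s : C := ((d / 2)%:C)%C.
  have Ds : punctured_disc 0 d s.
    have ms : md s = d / 2 by rewrite /s md_real gtr0_norm.
    by rewrite /punctured_disc /mkset subr0 ms d2 ltr_pdivrMr // ltr_pMr // ltr1n.
  have Dys : punctured_disc 0 d (y * s).
    by move: Ds; rewrite /punctured_disc /= !subr0 mdM my mul1r.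
  have := unity_constant k0 (@punctured_connected R 0 d) cH Hk Ds Dys.
  have G0 : G1 (a + s ^+ k) != 0.
    have := Hk _ Ds; apply: contra_eq_neq; rewrite /H => ->.
    by rewrite mul0r expr0n gtn_eqF // eq_sym oner_eq0.
  have sm0 : s ^+ m != 0 by rewrite expf_neq0 // s0P.
  rewrite /H exprMn (prim_expr_order yk) mul1r => /(mulfI G0).
  rewrite exprMn => /invr_inj /eqP; rewrite -[X in X == _]mul1r.
  by rewrite (inj_eq (mulIf sm0)) eq_sym (prim_order_dvd yk).
pose q := (m %/ k)%N; have mE : m = (q * k)%N by rewrite divnK.
pose H2 w := G1 w * ((w - a) ^+ q)^-1.
have wa w : punctured_disc a d w -> w - a != 0.
  by move=> /andP[]; rewrite md_gt0.
have hwa w : holomorphic_at (fun w => w - a) w.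
  exact: (holoB (holo_id w) (holo_cst a w)).
have cH2 w : punctured_disc a d w -> {for w, continuous H2}.
  move=> Dw; apply: (continuousM_at (cG1 _ Dw)).
  apply: (@continuousV_at R C (fun w => (w - a) ^+ q)); first by rewrite expf_neq0 // wa.
  exact: holo_continuous_at (holoX q (hwa w)).
have H2k w : punctured_disc a d w -> H2 w ^+ k = 1.
  move=> Dw; rewrite /H2 exprMn (G1k _ Dw) exprVn -exprM -mE.
  by rewrite divff // expf_neq0 // wa.
pose w0 : C := a + ((d / 2)%:C)%C.
have Dw0 : punctured_disc a d w0.
  have mw : md (w0 - a) = d / 2.
    by rewrite /w0 addrAC subrr add0r md_real gtr0_norm // divr_gt0.
  by rewrite /punctured_disc /mkset mw divr_gt0 //= ltr_pdivrMr // ltr_pMr // ltr1n.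
exists (fun w => H2 w0 * ((w - a) ^+ q * v w)); split.
- exact: (holoM (holo_cst _ _) (holoM (holoX q (hwa a)) hv)).
- by rewrite mE muln_gt0 => /andP[q0 _]; rewrite subrr expr0n gtn_eqF // mul0r mulr0.
apply/nbhs_md; exists d => // w wd wa0.
have Dw : punctured_disc a d w by rewrite /punctured_disc /= md_gt0 subr_eq0 wa0.
rewrite (unity_constant k0 (@punctured_connected R a d) cH2 H2k Dw0 Dw) /H2 /G1.
have [_ v0 _] := ve _ (Dde _ Dw).
by rewrite mulrA divfK ?expf_neq0 ?wa // divfK.
Qed.

End removable.

(** * Germs of meromorphic functions *)

Section meromorphic_germs.
Variable R : realType.
Local Notation C := (cplx R).
Implicit Types (f g u v A B : C -> C) (a : C).

(** Quotients of holomorphic germs, rather than Laurent expansions: closure under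
    the field operations is then immediate. *)
Definition mero_at f a := exists A B,
  [/\ holomorphic_at A a, holomorphic_at B a &
      \forall w \near a, w != a -> B w != 0 /\ f w = A w / B w].

Lemma mero_near f g a : (\forall w \near a, w != a -> f w = g w) ->
  mero_at f a -> mero_at g a.
Proof.
move=> fg [A [B [hA hB H]]]; exists A, B; split; [exact: hA|exact: hB|].
apply: (@filterS2 _ (nbhs a) _ _ _ _ _ fg H) => w e h wa; rewrite -e //; exact: h.
Qed.

Lemma mero_holo f a : holomorphic_at f a -> mero_at f a.
Proof.
move=> hf; exists f, (fun=> 1); split; [exact: hf|exact: holo_cst|].
by apply: (@filterE _ (nbhs a)) => w _; rewrite oner_neq0 divr1.
Qed.

Lemma mero_cst (k : C) a : mero_at (fun=> k) a.
Proof. exact: mero_holo (holo_cst k a). Qed.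

Lemma meroM f g a : mero_at f a -> mero_at g a -> mero_at (fun w => f w * g w) a.
Proof.
move=> [A [B [hA hB H]]] [A' [B' [hA' hB' H']]].
exists (fun w => A w * A' w), (fun w => B w * B' w); split.
- exact: holoM hA hA'.
- exact: holoM hB hB'.
apply: (@filterS2 _ (nbhs a) _ _ _ _ _ H H') => w h h' wa.
have [B0 ->] := h wa; have [B'0 ->] := h' wa.
by rewrite mulf_neq0 // invfM mulrACA.
Qed.

Lemma meroD f g a : mero_at f a -> mero_at g a -> mero_at (fun w => f w + g w) a.
Proof.
move=> [A [B [hA hB H]]] [A' [B' [hA' hB' H']]].
exists (fun w => A w * B' w + A' w * B w), (fun w => B w * B' w); split.
- exact: holoD (holoM hA hB') (holoM hA' hB).
- exact: holoM hB hB'.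
apply: (@filterS2 _ (nbhs a) _ _ _ _ _ H H') => w h h' wa.
have [B0 ->] := h wa; have [B'0 ->] := h' wa.
by rewrite mulf_neq0 //; split=> //; field; rewrite B0 B'0.
Qed.

Lemma meroV f a : (\forall w \near a, w != a -> f w != 0) ->
  mero_at f a -> mero_at (fun w => (f w)^-1) a.
Proof.
move=> f0 [A [B [hA hB H]]]; exists B, A; split; [exact: hB|exact: hA|].
apply: (@filterS2 _ (nbhs a) _ _ _ _ _ f0 H) => w fw h wa.
have [B0 fE] := h wa; move: (fw wa); rewrite fE invf_div => n; split=> //.
by apply: contraNneq n => ->; rewrite mul0r.
Qed.

Lemma mero_horner (p : {poly C}) f a : mero_at f a -> mero_at (fun w => p.[f w]) a.
Proof.
move=> hf; elim/poly_ind: p => [|p c IH].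
  have -> : (fun w => (0 : {poly C}).[f w]) = (fun=> 0) by apply/funext => w; rewrite horner0.
  exact: mero_cst.
have -> : (fun w => (p * 'X + c%:P).[f w]) = (fun w => p.[f w] * f w + c).
  by apply/funext => w; rewrite hornerMXaddC.
exact: meroD (meroM IH hf) (mero_cst c a).
Qed.

(** Comparing the orders at a of numerator and denominator decides whether f or
    1/f is holomorphic; in the first case factor f minus its value at a. *)
Lemma mero_cases f a : mero_at f a ->
  [\/ exists k, \forall w \near a, w != a -> f w = k,
      exists k m u, [/\ (0 < m)%N, holomorphic_at u a, u a != 0 &
        \forall w \near a, w != a -> f w = k + (w - a) ^+ m * u w] |
      exists m u, [/\ (0 < m)%N, holomorphic_at u a, u a != 0 &
        \forall w \near a, w != a -> (f w)^-1 = (w - a) ^+ m * u w]].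
Proof.
move=> [A [B [hA hB H]]].
have [A0|[p [u [hu u0 Ap]]]] := holo_factor hA.
  constructor 1; exists 0; apply: (@filterS2 _ (nbhs a) _ _ _ _ _ A0 H) => w Aw h wa.
  by have [_ ->] := h wa; rewrite Aw mul0r.
have [B0|[q [v [hv v0 Bq]]]] := holo_factor hB.
  constructor 1; exists 0; apply: (@filterS2 _ (nbhs a) _ _ _ _ _ B0 H) => w Bw h wa.
  by have [] := h wa; rewrite Bw eqxx.
have nu := cont_neq0 (holo_continuous_at hu) u0.
have nv := cont_neq0 (holo_continuous_at hv) v0.
have {H} H : \forall w \near a, [/\ A w = (w - a) ^+ p * u w, B w = (w - a) ^+ q * v w,
    u w != 0, v w != 0 & w != a -> f w = A w / B w].
  have [h1 h2] := (filterI nu nv, filterI Ap Bq).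
  apply: (@filterS3 _ (nbhs a) _ _ _ _ _ _ h1 h2 H) => w [? ?] [? ?] h; split=> // /h[].
  by [].
have [pq|qp] := ltnP p q.
  constructor 3; exists (q - p)%N, (fun w => v w * (u w)^-1); split.
  - by rewrite subn_gt0.
  - exact: (holoM hv (holoV u0 hu)).
  - by rewrite mulf_neq0 // invr_eq0.
  apply: (@filterS _ (nbhs a) _ _ _ _ H) => w [Aw Bw uw vw fw] wa.
  rewrite fw // invf_div Aw Bw -{1}(subnK (ltnW pq)) exprD.
  by field; rewrite uw expf_neq0 // subr_eq0.
pose g w := (w - a) ^+ (p - q) * (u w * (v w)^-1).
have hg : holomorphic_at g a.
  apply: (holoM (holoX _ (holoB (holo_id a) (holo_cst a a)))).
  exact: (holoM hu (holoV v0 hv)).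
have fg : \forall w \near a, w != a -> f w = g w.
  apply: (@filterS _ (nbhs a) _ _ _ _ H) => w [Aw Bw uw vw fw] wa.
  rewrite fw // Aw Bw -{1}(subnK qp) exprD /g.
  by field; rewrite vw expf_neq0 // subr_eq0.
have hga : holomorphic_at (fun w => g w - g a) a := holoB hg (holo_cst _ _).
have [ga|[m [s [hs s0 sE]]]] := holo_factor hga.
  constructor 1; exists (g a).
  apply: (@filterS2 _ (nbhs a) _ _ _ _ _ ga fg) => w gw fw wa.
  by rewrite fw //; apply/eqP; rewrite -subr_eq0; apply/eqP.
constructor 2; exists (g a), m, s; split; [|exact: hs|exact: s0|].
  have /eqP := nbhs_singleton sE; rewrite subrr eq_sym mulf_eq0 (negbTE s0) orbF.
  by rewrite subrr expf_eq0 => /andP[].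
apply: (@filterS2 _ (nbhs a) _ _ _ _ _ sE fg) => w gw fw wa.
by rewrite fw // -gw addrC subrK.
Qed.

End meromorphic_germs.

(** * The topology of the sphere *)

Section sphere_topology.
Variable R : realType.
Local Notation C := (cplx R).
Local Notation S := (sphere R).

Lemma md_continuous : continuous (@md R : C -> R).
Proof.
move=> a; apply/(@cvgrPdist_lt _ _ _ (nbhs a)) => e e0; apply/nbhs_md; exists e => // w.
apply: le_lt_trans; rewrite ler_norml; apply/andP; split.
  by rewrite lerNl opprB lerBlDr (le_trans _ (mdD _ _)) // subrK.
by rewrite lerBlDr mdB (le_trans _ (mdD _ _)) // subrK.
Qed.

Lemma disk_compact (M : R) : compact [set w : C | md w <= M].
Proof.
pose f (p : R * R) : C := (p.1%:C)%C + (0 +i* 1 : C)%C * (p.2%:C)%C.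
have cf : continuous f.
  move=> p; apply: (@continuousD C C (R * R)%type (fun p : R * R => (p.1%:C)%C)).
    by apply: (@continuous_comp _ _ _ fst (fun t : R => ((t%:C)%C : C)));
      [exact: cvg_fst|exact: real_complex_continuous].
  apply: continuousM; first exact: cst_cplx_continuous.
  by apply: (@continuous_comp _ _ _ snd (fun t : R => ((t%:C)%C : C)));
    [exact: cvg_snd|exact: real_complex_continuous].
apply: (@subclosed_compact _ _ (f @` (`[- M, M] `*` `[- M, M]))).
- apply: (@preimage_closed C R (@md R) [set x | x <= M]); last exact: closed_le.
  by move=> x _; exact: md_continuous.
- apply: continuous_compact; first exact: continuous_subspaceT.
  by apply: compact_setX; exact: segment_compact.
move=> w wM; exists (complex.Re w, complex.Im w); last first.
  by case: w {wM} => x y; rewrite /f /=; simpc.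
have [h1 h2] := Re_Im_le_md w.
by split; rewrite /= in_itv /= -ler_norml (le_trans _ wM).
Qed.

Lemma sphere_hausdorff : hausdorff_space S.
Proof.
apply: one_point_compactification_hausdorff; last exact: (@norm_hausdorff C C).
move=> x _; exists [set w | md w <= md x + 1].
  apply/nbhs_md; exists 1 => // w wx _ /=.
  have : md w <= md (w - x) + md x by rewrite (le_trans _ (mdD _ _)) // subrK.
  by move: wx; lra.
by split; [exact: disk_compact|apply: compact_closed; [exact: (@norm_hausdorff C C)|exact: disk_compact]].
Qed.

Lemma nbhs_SomeE (a : C) (P : set S) :
  nbhs (Some a : S) P = (\forall w \near a, P (Some w)).
Proof. by []. Qed.

(** Compact sets are bounded, and closed discs are compact. *)
Lemma nbhs_NoneP (P : set S) :
  nbhs (None : S) P <-> P None /\ exists M : R, forall w, M < md w -> P (Some w).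
Proof.
split=> [[W [cW _] WP]|[PN [M MP]]].
  split; first by apply: WP; right.
  have [W0|W0] := eqVneq W set0.
    by exists 0 => w _; apply: WP; left; exists w => // W0w; have : set0 w by rewrite -W0.
  have cmW : compact (@md R @` W).
    by apply: continuous_compact => //; apply: continuous_subspaceT; exact: md_continuous.
  have [w0 Ww0] : W !=set0 by exact/set0P.
  have [_ [M MW]] := compact_has_sup (ex_intro _ (md w0) (ex_intro2 _ _ w0 Ww0 erefl)) cmW.
  exists M => w wM; apply: WP; left; exists w => // Ww.
  by have := MW (md w) (ex_intro2 _ _ w Ww erefl); rewrite leNgt wM.
exists [set w | md w <= M].
  split; [exact: disk_compact|apply: compact_closed; [exact: (@norm_hausdorff C C)|exact: disk_compact]].
move=> _ [[w /= wM <-]|-> //]; apply: MP; rewrite ltNge; exact/negP.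
Qed.

Lemma sphere_inv_continuous : continuous (@sphere_inv R).
Proof.
move=> [x|]; last first.
  move=> P /=; rewrite nbhs_SomeE => /nbhs_md[e e0 eP]; apply/nbhs_NoneP; split.
    by apply: eP; rewrite subrr md0.
  exists e^-1 => w we; rewrite /= ; have w0 : w != 0.
    by rewrite -md_gt0 (lt_trans _ we) // invr_gt0.
  rewrite (negbTE w0); apply: eP; rewrite subr0 mdV.
  by rewrite invf_plt ?posrE // md_gt0.
have [->|x0] := eqVneq x 0.
  have i0 : sphere_inv (Some 0 : S) = None by rewrite /= eqxx.
  move=> P; rewrite i0 => /nbhs_NoneP[PN [M MP]]; apply/nbhs_md; exists (`|M| + 1)^-1.
    by rewrite invr_gt0 ltr_wpDl.
  move=> w; rewrite subr0 /= => wM; have [//|w0] := eqVneq w 0.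
  apply: MP; rewrite mdV; have mw : 0 < md w by rewrite md_gt0.
  rewrite (le_lt_trans (ler_norm M)) // (@lt_le_trans _ _ (`|M| + 1)) //; first by rewrite ltrDl.
  by rewrite -[leLHS]invrK lef_pV2 ?posrE ?invr_gt0 ?ltr_wpDl // ltW.
have ix : sphere_inv (Some x : S) = Some x^-1 by rewrite /= (negbTE x0).
move=> P; rewrite ix nbhs_SomeE => xP.
have h1 := @continuousV_at R C id x x0 (@cvg_id _ (nbhs x)).
have /= := h1 _ xP; rewrite /nbhs /=.
have h2 := @cont_neq0 _ id x (@cvg_id _ (nbhs x)) x0.
move: h2; apply: (@filterS2 _ (nbhs x)) => w /= w0 ?; by rewrite (negbTE w0).
Qed.

(** The junk value 0 at infinity is consistent with 0^-1 = 0: taking the finite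
    part commutes with inversion everywhere. *)
Definition fin (x : S) : C := if x is Some w then w else 0.

Lemma Some_continuous : continuous (Some : C -> S).
Proof. exact: one_point_compactification_some_continuous. Qed.

Lemma fin_continuous (a : C) : {for (Some a : S), continuous fin}.
Proof. by move=> P /= aP; rewrite /nbhs. Qed.

Lemma continuous_fin (T : topologicalType) (f : T -> S) (a : C) (x : T) : f x = Some a ->
  {for x, continuous f} -> {for x, continuous (fun y => fin (f y))}.
Proof.
move=> fx cf; apply: (@continuous_comp T S C f fin); first exact: cf.
by rewrite fx; exact: fin_continuous.
Qed.

End sphere_topology.

(** * Coverings and meromorphic functions on a Riemann surface *)

Lemma nearI (T : topologicalType) (x : T) (P Q : set T) :
  (\forall y \near x, P y) -> (\forall y \near x, Q y) ->
  \forall y \near x, P y /\ Q y.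
Proof. exact: filterI. Qed.

Section charts.
Variables (R : realType) (X : topologicalType).
Local Notation C := (cplx R).
Implicit Types (t : chart R X) (x y : X).

Lemma chart_inj t x y : chart_dom t x -> chart_dom t y -> t x = t y -> x = y.
Proof. by move=> tx ty e; rewrite -(chart_coordK tx) e chart_coordK. Qed.

(** Passing from neighbourhoods of x in X to neighbourhoods of t x in C; the
    image of the chart is open, so t inverts chart_param near t x. *)
Lemma near_chart_param t x (P : set X) : chart_dom t x ->
  (\forall y \near x, P y) ->
  \forall w \near t x, [/\ chart_dom t (chart_param t w),
    t (chart_param t w) = w & P (chart_param t w)].
Proof.
move=> tx xP; have cx : (t @` chart_dom t) (t x) by exists x.
have h1 : \forall w \near t x, (t @` chart_dom t) w.
  by apply: open_nbhs_nbhs; split => //; exact: chart_cod_open.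
have h2 : \forall w \near t x, P (chart_param t w).
  by have := chart_param_continuous cx; apply; rewrite chart_coordK.
apply: (@filterS2 _ (nbhs (t x)) _ _ _ _ _ h1 h2) => w [y ty <-] Pw.
by move: Pw; rewrite chart_coordK.
Qed.

Lemma near_chart_coord t x (Q : set C) : chart_dom t x ->
  (\forall w \near t x, Q w) -> \forall y \near x, chart_dom t y /\ Q (t y).
Proof.
move=> tx xQ; have h1 : \forall y \near x, chart_dom t y.
  by apply: open_nbhs_nbhs; split => //; exact: chart_dom_open.
have h2 := chart_coord_continuous tx xQ.
exact: (@filterS2 _ (nbhs x) _ _ _ _ _ h1 h2).
Qed.

Lemma near_cofinite (T : topologicalType) (F : set T) (x : T) :
  hausdorff_space T -> finite_set F -> \forall y \near x, y <> x -> ~ F y.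
Proof.
move=> hT fF; have cl : closed (F `\ x).
  by apply: (accessible_finite_set_closed.1 (hausdorff_accessible hT)); exact: finite_setD.
have : \forall y \near x, (~` (F `\ x)) y.
  by apply: open_nbhs_nbhs; split; [exact: closed_openC|move=> [_ ]; exact].
by apply: filterS => y nF yx Fy; apply: nF.
Qed.

Lemma punctured_point (a : C) (P : set C) : (\forall w \near a, P w) ->
  exists2 w, w != a & P w.
Proof.
move=> /nbhs_md[e e0 eP]; have h : md (((e / 2)%:C)%C : C) = e / 2.
  by rewrite md_real gtr0_norm // divr_gt0.
exists (a + ((e / 2)%:C)%C).
  by rewrite -subr_eq0 addrAC subrr add0r -md_gt0 h divr_gt0.
by apply: eP; rewrite addrAC subrr add0r h ltr_pdivrMr // ltr_pMr // ltr1n.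
Qed.

End charts.

Section surfaces.
Variables (R : realType) (X : riemann_surface R).
Local Notation C := (cplx R).
Local Notation S := (sphere R).
Implicit Types (x y : X) (z h : X -> S).

(** A chart identifies a neighbourhood of x with an open set of C, which has no
    isolated point. *)
Lemma surface_punctured_point x (P : set X) : (\forall y \near x, P y) ->
  exists2 y, y <> x & P y.
Proof.
move=> xP; have [t _ tx] := rs_cover x.
have [w wx [tw wK Pw]] := punctured_point (near_chart_param tx xP).
by exists (chart_param t w) => // e; move: wx; rewrite -wK e eqxx.
Qed.

Lemma cofinite_dense (F : set X) x (P : set X) : finite_set F ->
  (\forall y \near x, P y) -> exists2 y, ~ F y & P y.
Proof.
move=> fF xP; have h := near_cofinite x (@rs_hausdorff _ X) fF.
have [y yx [Py /(_ yx) Fy]] := surface_punctured_point (nearI xP h).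
by exists y.
Qed.

Lemma local_coordinate_near t x : local_coordinate t x ->
  \forall y \near x, chart_dom t y /\ (t y = 0 -> y = x).
Proof.
move=> [tx t0 _]; have : \forall y \near x, chart_dom t y.
  by apply: open_nbhs_nbhs; split => //; exact: chart_dom_open.
apply: filterS => y ty; split=> // ty0.
by apply: (chart_inj ty tx); rewrite ty0 t0.
Qed.

Lemma near_eq_continuous (T U : topologicalType) (f g : T -> U) (x : T) :
  (\forall y \near x, f y = g y) -> {for x, continuous g} -> {for x, continuous f}.
Proof.
move=> fg cg; rewrite /prop_for /continuous_at (nbhs_singleton fg).
apply: cvg_trans cg; apply: near_eq_cvg.
by apply: filterS fg => y ->.
Qed.

Lemma covering_continuous z : branched_covering z -> continuous z.
Proof.
move=> bz x; have [t [k [[tx t0 _] k0 zE]]] := bz x.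
have ct := chart_coord_continuous tx.
have hX (z0 w : C) : holomorphic_at (fun w => z0 + w ^+ k) w.
  exact: (holoD (holo_cst z0 w) (holoX k (holo_id w))).
case: zE => [[z0 zE]|zE]; apply: (near_eq_continuous zE).
  apply: (@continuous_comp _ C S (fun y => z0 + t y ^+ k) Some); last exact: Some_continuous.
  apply: (@continuous_comp _ C C t (fun w => z0 + w ^+ k)); first exact: ct.
  exact: holo_continuous_at (hX z0 _).
apply: (@continuous_comp _ S S (fun y => Some (t y ^+ k)) (@sphere_inv R)); last exact: sphere_inv_continuous.
apply: (@continuous_comp _ C S (fun y => t y ^+ k) Some); last exact: Some_continuous.
apply: (@continuous_comp _ C C t (fun w => w ^+ k)); first exact: ct.
exact: holo_continuous_at (holoX k (holo_id _)).
Qed.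

Lemma meromorphic_continuous h : meromorphic h -> continuous h.
Proof.
move=> [mh _] x; have [t tA tx] := rs_cover x.
have [g [hg hE]] := mh t x tA tx.
have cg : {for x, continuous (fun y => Some (g (t y)) : S)}.
  apply: (@continuous_comp _ C S (fun y => g (t y)) Some); last exact: Some_continuous.
  apply: (@continuous_comp _ C C t g); first exact: (chart_coord_continuous tx).
  exact: holo_continuous_at hg.
case: hE => hE; apply: (near_eq_continuous hE) => //.
apply: (@continuous_comp _ S S (fun y => Some (g (t y))) (@sphere_inv R)) => //.
exact: sphere_inv_continuous.
Qed.

(** In a local coordinate, z0 + t^k takes the value z0 at t = 0 only; over
    infinity the same holds for t^k and 0. *)
Lemma fibre_isolated z x : branched_covering z ->
  \forall y \near x, z y = z x -> y = x.
Proof.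
move=> bz; have [t [k [tl k0 zE]]] := bz x.
have [tx t0 _] := tl; have tn := local_coordinate_near tl.
have xk0 (w : C) : w ^+ k = 0 -> w = 0 by move/eqP; rewrite expf_eq0 k0 /= => /eqP.
case: zE => [[z0 zE]|zE]; have zx := nbhs_singleton zE;
  apply: filterS2 zE tn => y zy [ty inj]; rewrite zy zx t0 expr0n gtn_eqF //= ?addr0.
  by move=> [/(canRL (addKr _))]; rewrite addNr => /xk0; exact: inj.
by rewrite eqxx; case: eqVneq => // /xk0 /inj.
Qed.

(** An infinite fibre would have a cluster point in the compact space X, by the
    filter of its cofinite subsets; but every point of X has a neighbourhood
    containing no other point of the fibre. *)
Lemma fibre_finite z (w : S) : compact [set: X] -> branched_covering z ->
  finite_set (z @^-1` [set w]).
Proof.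
move=> cX bz.
have loc x : \forall y \near x, z y = w -> y = x.
  have [<-|zx] := pselect (z x = w); first exact: (fibre_isolated x bz).
  have : \forall s \near z x, s <> w.
    apply: open_nbhs_nbhs; split=> //; rewrite -[X in open X](setCK); apply: closed_openC.
    rewrite (_ : ~` _ = [set w]); last by apply/seteqP; split=> s /=; rewrite ?notK.
    apply: accessible_closed_set1; apply: hausdorff_accessible; exact: sphere_hausdorff.
  by move=> /(covering_continuous bz) h; apply: (@filterS _ (nbhs x) _ _ _ _ h) => y yw /yw.
apply: contrapT => inf; set F := z @^-1` [set w] in inf.
pose Fr : set_system X := [set A | finite_set (F `\` A)].
have PFr : ProperFilter Fr.
  split; first by rewrite /Fr /= setD0.
  split=> [|A B fA fB|A B AB fA]; rewrite /Fr /=.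
  - by rewrite setDT.
  - by rewrite setDIr finite_setU.
  - by apply: sub_finite_set fA => y [Fy nB]; split=> // /AB.
have FrT : Fr setT by rewrite /Fr /= setDT.
have [x [_ clx]] := cX Fr PFr FrT.
have FrD : Fr (F `\ x).
  apply: sub_finite_set (finite_set1 x) => y [Fy nF]; apply: contrapT => yx.
  exact: nF.
by have [y [[Fy yx] /(_ Fy)]] := clx _ _ FrD (loc x).
Qed.

Lemma preimage_finite z (F : set S) : compact [set: X] -> branched_covering z ->
  finite_set F -> finite_set (z @^-1` F).
Proof.
move=> cX bz fF.
apply: (@sub_finite_set _ _ (\bigcup_(w in F) (z @^-1` [set w]))).
  by move=> x Fx; exists (z x).
by apply: bigcup_finite => // w _; exact: fibre_finite.
Qed.

Lemma fin_inv (w : C) : fin (sphere_inv (Some w) : S) = w^-1.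
Proof. by rewrite /=; case: eqVneq => [->|//]; rewrite invr0. Qed.

(** The normal form z0 + t'^k holds in a local coordinate t', which is a
    holomorphic function of any chart t of the atlas. *)
Lemma covering_mero z t x : branched_covering z -> rs_atlas t -> chart_dom t x ->
  mero_at (fun w => fin (z (chart_param t w))) (t x).
Proof.
move=> bz tA tx; have [t' [k [tl k0 zE]]] := bz x.
have [t'x t'0 /(_ t tA)[_ /(_ x tx t'x)]] := tl; set tau := t' \o chart_param t => htau.
have hk : holomorphic_at (fun w => tau w ^+ k) (t x) := holoX k htau.
case: zE => [[z0 zE]|zE].
  apply: (@mero_near _ (fun w => z0 + tau w ^+ k)); last exact: mero_holo (holoD (holo_cst _ _) hk).
  have h := near_chart_param tx zE.
  by apply: (@filterS _ (nbhs (t x)) _ _ _ _ h) => w [_ _ ->].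
have h := near_chart_param tx (nearI zE (local_coordinate_near tl)).
apply: (@mero_near _ (fun w => (tau w ^+ k)^-1)).
  by apply: (@filterS _ (nbhs (t x)) _ _ _ _ h) => w [_ _ [-> _]]; rewrite fin_inv.
apply: meroV; last exact: mero_holo.
apply: (@filterS _ (nbhs (t x)) _ _ _ _ h) => w [_ wK [_ [_ inj]]]; apply: contraNneq.
move/eqP; rewrite expf_eq0 k0 /= => /eqP /inj wx.
by rewrite -wK wx.
Qed.

Lemma meromorphic_mero h t x : meromorphic h -> rs_atlas t -> chart_dom t x ->
  (\forall y \near x, y <> x -> h y <> None) ->
  mero_at (fun w => fin (h (chart_param t w))) (t x).
Proof.
move=> [mh _] tA tx hN; have [g [hg hE]] := mh t x tA tx.
case: hE => hE; have H := near_chart_param tx (nearI hE hN).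
  apply: (@mero_near _ g); last exact: mero_holo.
  by apply: (@filterS _ (nbhs (t x)) _ _ _ _ H) => w [_ wK [-> _]] _; rewrite /= wK.
apply: (@mero_near _ (fun w => (g w)^-1)).
  by apply: (@filterS _ (nbhs (t x)) _ _ _ _ H) => w [_ wK [-> _]] _; rewrite fin_inv wK.
apply: meroV; last exact: mero_holo.
apply: (@filterS _ (nbhs (t x)) _ _ _ _ H) => w [_ wK [hw hn]] wx.
apply/eqP => gw; apply: hn; last by rewrite hw wK /= gw eqxx.
by move=> e; move: wx; rewrite -wK e eqxx.
Qed.

End surfaces.

(** * Extension of a lift through a branched covering *)

Section extension.
Variables (R : realType) (X Y : riemann_surface R).
Local Notation C := (cplx R).
Local Notation S := (sphere R).
Implicit Types (x : X) (y : Y).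

Definition punctured_limit (f : X -> Y) x y :=
  forall U : set Y, nbhs y U -> \forall x' \near x, x' <> x -> U (f x').

Lemma punctured_limit_unique f x y y' :
  punctured_limit f x y -> punctured_limit f x y' -> y = y'.
Proof.
move=> l l'; apply: (@rs_hausdorff _ Y) => A B yA y'B.
have [x' x'x [Ax Bx]] := surface_punctured_point (nearI (l _ yA) (l' _ y'B)).
by exists (f x'); split; [exact: Ax|exact: Bx].
Qed.

Lemma near_punctured_disc (a : C) (P : set C) :
  (\forall w \near a, w != a -> P w) ->
  exists2 e : R, 0 < e & forall w, punctured_disc a e w -> P w.
Proof.
move=> /nbhs_md[e e0 eP]; exists e => // w /andP[w0 we]; apply: eP => //.
by rewrite -subr_eq0 -md_gt0.
Qed.

Lemma punctured_disc_near (a : C) (e : R) (P : set C) : 0 < e ->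
  (forall w, punctured_disc a e w -> P w) -> \forall w \near a, w != a -> P w.
Proof.
move=> e0 eP; apply/nbhs_md; exists e => // w we wa; apply: eP.
by rewrite /punctured_disc /= md_gt0 subr_eq0 wa.
Qed.

(** If r o f has a limit R0 at the puncture, so has f. By compactness f has a
    cluster value y, and r y = R0. The fibre of r near y is {y}, so the boundary
    of a small neighbourhood B of y is compact with an image missing R0: close
    to the puncture f avoids that boundary. The punctured disc being connected,
    f stays in B once it meets B. *)
Lemma punctured_disc_limit (r : Y -> S) (f : C -> Y) (a : C) (R0 : S) (e : R) :
  compact [set: Y] -> branched_covering r -> 0 < e ->
  (forall w, punctured_disc a e w -> {for w, continuous f}) ->
  (forall U, nbhs R0 U -> \forall w \near a, w != a -> U (r (f w))) ->
  exists y, r y = R0 /\ forall U, nbhs y U -> \forall w \near a, w != a -> U (f w).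
Proof.
move=> cY br e0 cf rf; have cr := covering_continuous br.
pose F := f @ a^'.
have PF : ProperFilter F by exact: fmap_proper_filter.
have FE A : F A <-> \forall w \near a, w != a -> A (f w) by [].
have [y [_ cly]] := cY F PF (@filterT _ F _).
have ry : r y = R0.
  apply/esym; apply: (@sphere_hausdorff R) => A B R0A yB.
  have [y' [Ay By]] := cly _ _ ((FE (r @^-1` A)).2 (rf _ R0A)) (cr y B yB).
  by exists (r y').
exists y; split=> // U yU.
have yW : nbhs y (U `&` [set y' | r y' = r y -> y' = y]).
  exact: nearI yU (fibre_isolated y br).
have [B yB clB] := @compact_regular _ y [set: Y] (@rs_hausdorff _ Y) cY filterT _ yW.
pose D := closure B `\` B°.
have cD : compact D.
  apply: (@subclosed_compact _ _ [set: Y]) => //.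
  by apply: closedI; [exact: closed_closure|apply: open_closedC; exact: open_interior].
have R0D : nbhs R0 (~` (r @` D)).
  apply: open_nbhs_nbhs; split.
    apply: closed_openC; apply: compact_closed; first exact: sphere_hausdorff.
    by apply: continuous_compact => //; exact: continuous_subspaceT.
  move=> [y' [/clB[_ inj] nB] ry']; apply: nB.
  by rewrite (inj _) ?ry' ?ry //; exact: yB.
have [e1 e10 e1P] := near_punctured_disc (rf _ R0D).
pose d := Num.min e e1.
have d0 : 0 < d by rewrite lt_min e0.
have Dd w : punctured_disc a d w -> punctured_disc a e w /\ punctured_disc a e1 w.
  by rewrite /punctured_disc /= lt_min => /and3P[-> -> ->].
have cA : connected (f @` punctured_disc a d).
  apply: connected_continuous_connected; first exact: punctured_connected.
  by apply: continuous_in_subspaceT => w /set_mem /Dd[/cf].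
have sep : separated B° (~` closure B).
  split; apply/seteqP; split=> // y'.
    move=> [clB' nB]; apply: nB; move: clB'; apply: closureS; exact: interior_subset.
  move=> [By' cl]; have [y'' [nB By'']] := cl _ (open_nbhs_nbhs (conj (open_interior B) By')).
  by apply: nB; apply: subset_closure; exact: interior_subset By''.
have cov : f @` punctured_disc a d `<=` B° `|` ~` closure B.
  move=> _ [w /Dd[_ /e1P h] <-]; have [Bw|nBw] := pselect (B° (f w)); first by left.
  by right => clw; apply: h; exists (f w).
have [sub|sub] := connected_subset sep cov cA.
  apply: (punctured_disc_near d0) => w dw.
  have Bw : B (f w) by apply: interior_subset; apply: sub; exists w.
  by have [] := clB _ (subset_closure Bw).
have FD : F (f @` punctured_disc a d).
  by apply/FE; apply: (punctured_disc_near d0) => w dw; exists w.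
have [y' [Dy' By']] := cly _ _ FD yB.
by case: (sub _ Dy'); exact: subset_closure.
Qed.

(** The coordinate on the sphere, centred at R0, in which a branched covering
    reads t |-> t ^ k; R0 is None at infinity. *)
Definition recentre (R0 : S) (v : C) : C := if R0 is Some k then v - k else v^-1.

Lemma covering_recentre (r : Y -> S) y (R0 : S) : r y = R0 -> branched_covering r ->
  exists (t' : chart R Y) k, [/\ local_coordinate t' y, (0 < k)%N &
    \forall y' \near y, forall v, r y' = Some v -> t' y' ^+ k = recentre R0 v].
Proof.
move=> <- /(_ y)[t [k [tl k0 zE]]]; exists t, k; split=> //; have [_ t0 _] := tl.
case: zE => [[z0 zE]|zE]; have := nbhs_singleton zE; rewrite t0 expr0n gtn_eqF // => ->.
  by apply: filterS zE => y' -> v [<-]; rewrite /= addr0 addrC addKr.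
apply: filterS zE => y' -> v; rewrite /= eqxx; case: eqVneq => // _ [<-].
by rewrite /= invrK.
Qed.

(** The situation: phi0 lifts the meromorphic function rc through r, away from
    finitely many points. *)
Variables (r : Y -> S) (X0 : set X) (phi0 : X -> Y) (rc : X -> C).
Hypotheses (cY : compact [set: Y]) (br : branched_covering r).
Hypothesis X0fin : finite_set (~` X0).
Hypothesis phi0_cont : forall x, X0 x -> {for x, continuous phi0}.
Hypothesis r_phi0 : forall x, X0 x -> r (phi0 x) = Some (rc x).
Hypothesis rc_mero : forall t x, rs_atlas t -> chart_dom t x ->
  mero_at (fun w => rc (chart_param t w)) (t x).
Hypothesis rc_fibre : forall v : C, finite_set [set x | X0 x /\ rc x = v].

Lemma near_X0 x : \forall x' \near x, x' <> x -> X0 x'.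
Proof.
have := near_cofinite x (@rs_hausdorff _ X) X0fin.
by apply: filterS => y h /h; exact: contrapT.
Qed.

(** The fibres of rc being finite, the constant case of mero_cases is excluded. *)
Lemma rc_local t x : rs_atlas t -> chart_dom t x ->
  exists m u, [/\ (0 < m)%N, holomorphic_at u (t x), u (t x) != 0 &
    (exists k, \forall w \near t x, w != t x ->
       rc (chart_param t w) = k + (w - t x) ^+ m * u w) \/
    (\forall w \near t x, w != t x ->
       (rc (chart_param t w))^-1 = (w - t x) ^+ m * u w)].
Proof.
move=> tA tx; have [[k H]|[k [m [u [m0 hu u0 H]]]]|[m [u [m0 hu u0 H]]]] := mero_cases (rc_mero tA tx).
- exfalso.
  have n1 := near_cofinite x (@rs_hausdorff _ X) (rc_fibre k).
  have H1 := near_chart_param tx (nearI n1 (near_X0 x)).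
  have [w wx [[_ wK [h1 h2]] h3]] := punctured_point (nearI H1 H).
  have px : chart_param t w <> x by move=> ex; move: wx; rewrite -wK ex eqxx.
  by apply: (h1 px); split; [exact: h2|exact: h3].
- by exists m, u; split=> //; left; exists k.
- by exists m, u; split=> //; right.
Qed.

(** Let y be the limit of phi0 at x and t' a coordinate at y in which r is
    t' |-> t'^k. Then t' o phi0 is a continuous k-th root of the recentred rc,
    which is (w - t x)^m u, so it is holomorphic by root_removable. *)
Lemma extend_local t x : rs_atlas t -> chart_dom t x ->
  exists y (t' : chart R Y) (G : C -> C),
   [/\ local_coordinate t' y, holomorphic_at G (t x), G (t x) = 0,
       \forall w \near t x, w != t x ->
         [/\ X0 (chart_param t w), chart_dom t' (phi0 (chart_param t w)) &
             t' (phi0 (chart_param t w)) = G w] &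
       punctured_limit phi0 x y].
Proof.
move=> tA tx; have [m [u [m0 hu u0 H]]] := rc_local tA tx.
pose f w := phi0 (chart_param t w).
have nX0 : \forall w \near t x, w != t x ->
    [/\ X0 (chart_param t w), {for w, continuous f} & r (f w) = Some (rc (chart_param t w))].
  have H0 := near_chart_param tx (near_X0 x).
  have Hc : \forall w \near t x, (t @` chart_dom t) w.
    by apply: open_nbhs_nbhs; split; [exact: chart_cod_open|exists x].
  apply: (@filterS2 _ (nbhs (t x)) _ _ _ _ _ H0 Hc) => w [tw wK h] cw wx.
  have Xw : X0 (chart_param t w) by apply: h => ex; move: wx; rewrite -wK ex eqxx.
  split=> //; last exact: r_phi0.
  by apply: continuous_comp; [exact: chart_param_continuous|exact: phi0_cont].
have [e e0 eP] := near_punctured_disc nX0.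
have hwm : holomorphic_at (fun w => (w - t x) ^+ m * u w) (t x).
  exact: (holoM (holoX m (holoB (holo_id _) (holo_cst _ _))) hu).
set g := (fun w => (w - t x) ^+ m * u w) in hwm.
have wm0 : g (t x) = 0 by rewrite /g subrr expr0n gtn_eqF // mul0r.
have [R0 [cvR gE]] : exists R0 : S,
    (forall U, nbhs R0 U -> \forall w \near t x, w != t x -> U (r (f w))) /\
    \forall w \near t x, w != t x -> recentre R0 (rc (chart_param t w)) = g w.
  have cg := holo_continuous_at hwm.
  case: H => [[k H]|H].
    exists (Some k); split; last first.
      by apply: (@filterS _ (nbhs (t x)) _ _ _ _ H) => w h wx; rewrite /recentre h // addrC addKr.
    move=> U kU; have : {for t x, continuous (fun w => Some (k + g w) : S)}.
      apply: (@continuous_comp _ C S (fun w => k + g w) Some); last exact: Some_continuous.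
      exact: (holo_continuous_at (holoD (holo_cst k (t x)) hwm)).
    move=> cU; have kU' : nbhs (Some (k + g (t x)) : S) U by rewrite wm0 addr0.
    have h := cU U kU'.
    apply: (@filterS3 _ (nbhs (t x)) _ _ _ _ _ _ h H nX0) => w hU hr n wx.
    by have [_ _ ->] := n wx; rewrite hr.
  exists None; split=> // U nU.
  have : {for t x, continuous (fun w => sphere_inv (Some (g w)) : S)}.
    apply: (@continuous_comp _ S S (fun w => Some (g w)) (@sphere_inv R)); last exact: sphere_inv_continuous.
    apply: (@continuous_comp _ C S g Some); [exact: cg|exact: Some_continuous].
  have i0 : sphere_inv (Some 0 : S) = None by rewrite /= eqxx.
  move=> cU; have nU' : nbhs (sphere_inv (Some (g (t x))) : S) U by rewrite wm0 i0.
  have h := cU U nU'.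
  have n0 := cont_neq0 (holo_continuous_at hu) u0.
  apply: (@filterS3 _ (nbhs (t x)) _ _ _ _ _ _ (nearI h n0) H nX0) => w [hU uw] hr n wx.
  have [_ _ ->] := n wx; move: hU; rewrite /= -[g w]hr //.
  rewrite invr_eq0 invrK ifF //; apply/negbTE; rewrite -invr_eq0 hr //.
  by rewrite mulf_neq0 // expf_neq0 // subr_eq0.
have cf w : punctured_disc (t x) e w -> {for w, continuous f} by case/eP.
have [y [ry ly]] := punctured_disc_limit cY br e0 cf cvR.
have [t' [k [tl k0 kE]]] := covering_recentre ry br.
have [t'y t'0 _] := tl.
have dom' : \forall y' \near y, chart_dom t' y' by have := local_coordinate_near tl; apply: filterS => ? [].
have H1 := nearI nX0 (nearI (ly _ (nearI dom' kE)) gE).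
have [e1 e10 e1P] : exists2 e1 : R, 0 < e1 & forall w, punctured_disc (t x) e1 w ->
   [/\ X0 (chart_param t w), {for w, continuous f}, chart_dom t' (f w) & t' (f w) ^+ k = g w].
  apply: near_punctured_disc.
  apply: (@filterS _ (nbhs (t x)) _ _ _ _ H1) => w [h1 [h2 h3]] wx.
  have [X0w cw rw] := h1 wx; have [dw kw] := h2 wx.
  by split=> //; rewrite (kw _ rw) h3.
have cF w : punctured_disc (t x) e1 w -> {for w, continuous (fun w => t' (f w))}.
  move=> /e1P[_ cw dw _]; apply: (@continuous_comp _ _ _ f t') => //.
  exact: chart_coord_continuous.
have Fk w : punctured_disc (t x) e1 w -> t' (f w) ^+ k = (w - t x) ^+ m * u w.
  by case/e1P.
have [G [hG G0 GE]] := root_removable k0 e10 hu u0 cF Fk.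
have e1N := punctured_disc_near e10 e1P.
have lim : punctured_limit phi0 x y.
  move=> U /ly /(near_chart_coord tx); apply: filterS => x' [tx' h] x'x.
  have : U (f (t x')) by apply: h; apply: contra_notN x'x => /eqP; exact: (chart_inj tx' tx).
  by rewrite /f chart_coordK.
exists y, t', G; split; [exact: tl|exact: hG|exact: G0| |exact: lim].
apply: (@filterS2 _ (nbhs (t x)) _ _ _ _ _ e1N GE) => w h1 h2 wx.
by have [? _ ? _] := h1 wx; split=> //; exact: h2.
Qed.

(** The limits found locally are unique, hence glue, and agree with phi0 on X0
    where phi0 is continuous. *)
Lemma holomorphic_extension : exists phi : X -> Y,
  holomorphic_map phi /\ forall x, X0 x -> phi x = phi0 x.
Proof.
have /choice[phi phiP] : forall x, exists y, punctured_limit phi0 x y.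
  move=> x; have [t tA tx] := rs_cover x.
  by have [y [t' [G [_ _ _ _ ly]]]] := extend_local tA tx; exists y.
have phiE x : X0 x -> phi x = phi0 x.
  move=> Xx; apply: (punctured_limit_unique (phiP x)) => U /(phi0_cont Xx) h.
  by apply: (@filterS _ (nbhs x) _ _ _ _ h) => x' Ux' _; exact: Ux'.
exists phi; split=> //; split.
  move=> x U yU.
  have h := nearI (phiP x U yU) (near_X0 x).
  rewrite /nbhs /=; apply: filterS h => x' [h1 h2] /=.
  have [->|x'x] := pselect (x' = x); first exact: nbhs_singleton yU.
  by rewrite phiE; [exact: h1|exact: h2].
move=> t t'' tA tA'' x tx tpx.
have [y [t' [G [tl hG G0 GE ly]]]] := extend_local tA tx.
have yE : y = phi x := punctured_limit_unique ly (phiP x).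
have [t'y t'y0 /(_ _ tA'')[/(_ y t'y) htr _]] := tl.
rewrite yE in tl t'y t'y0 htr.
have hc : holomorphic_at ((t'' \o chart_param t') \o G) (t x).
  by apply: (holo_comp hG); rewrite G0 -t'y0; exact: htr.
apply: holo_near hc; apply: (@filterS _ (nbhs (t x)) _ _ _ _ GE) => w h /=.
have [->|wx] := eqVneq w (t x).
  by rewrite G0 -t'y0 !chart_coordK.
by have [Xw dw <-] := h wx; rewrite chart_coordK // phiE.
Qed.

End extension.

(** * Maps determined by a pair of meromorphic functions *)

Lemma hausdorff_prod (T U : topologicalType) :
  hausdorff_space T -> hausdorff_space U -> hausdorff_space (T * U)%type.
Proof.
move=> hT hU [p1 p2] [q1 q2] cl; congr (_, _).
  apply: hT => A B pA qB; have [[x y] [/= ? ?]] := cl _ _ (cvg_fst pA) (cvg_fst qB).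
  by exists x.
apply: hU => A B pA qB; have [[x y] [/= ? ?]] := cl _ _ (cvg_snd pA) (cvg_snd qB).
by exists y.
Qed.

Lemma continuous_pair (T U V : topologicalType) (f : T -> U) (g : T -> V) (x : T) :
  {for x, continuous f} -> {for x, continuous g} ->
  {for x, continuous (fun y => (f y, g y))}.
Proof.
move=> cf cg; apply: (@cvg_pair T U V (nbhs x) (nbhs (f x)) (nbhs (g x)) _ _ _ f g cf cg).
Qed.

(** A continuous map q from a compact space is closed, so points whose q-value
    is close to q y are close to y when y is alone in its fibre. *)
Lemma lift_continuous (X Y Z : topologicalType) (q : Y -> Z) (p : X -> Z)
    (phi : X -> Y) (x : X) :
  compact [set: Y] -> hausdorff_space Z -> continuous q -> {for x, continuous p} ->
  (\forall x' \near x, q (phi x') = p x') ->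
  (forall y, q y = p x -> y = phi x) -> {for x, continuous phi}.
Proof.
move=> cY hZ cq cp qp uniq U; rewrite nbhsE => -[V [oV Vx] VU].
pose K := q @` ~` V.
have cK : closed K.
  apply: compact_closed => //; apply: continuous_compact.
    exact: continuous_subspaceT.
  by apply: (@subclosed_compact _ _ [set: Y]) => //; exact: open_closedC.
have nK : nbhs (p x) (~` K).
  apply: open_nbhs_nbhs; split; first exact: closed_openC.
  by move=> [y nV /uniq yx]; apply: nV; rewrite yx.
have h := cp _ nK.
apply: (@filterS2 _ (nbhs x) _ _ _ _ _ h qp) => x' nK' qx' /=.
apply: VU; apply: contrapT => nV; apply: nK'.
by exists (phi x').
Qed.

Section lift.
Variables (R : realType) (X Y : riemann_surface R).
Local Notation C := (cplx R).
Local Notation S := (sphere R).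

(** Cofinite sets are dense. *)
Lemma continuous_eq_cofinite (f g : X -> Y) (F : set X) : finite_set F ->
  continuous f -> continuous g -> (forall x, ~ F x -> f x = g x) -> f =1 g.
Proof.
move=> fF cf cg fg x; apply: (@rs_hausdorff _ Y) => A B fA gB.
have [x' nF [Ax Bx]] := cofinite_dense fF (nearI (cf x A fA) (cg x B gB)).
by exists (f x'); split; [exact: Ax|rewrite fg].
Qed.

(** The pair (r, Delta) separates the relevant points of Y, so the pair (rc, dc)
    determines a map on X0; it is continuous there since (r, Delta) is a closed
    map, and then extends. *)
Lemma holomorphic_lift (r Delta : Y -> S) (X0 : set X) (rc dc : X -> C) :
  compact [set: Y] -> branched_covering r -> meromorphic Delta ->
  finite_set (~` X0) ->
  (forall t x, rs_atlas t -> chart_dom t x ->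
    mero_at (fun w => rc (chart_param t w)) (t x)) ->
  (forall v : C, finite_set [set x | X0 x /\ rc x = v]) ->
  (forall x, X0 x -> {for x, continuous rc} /\ {for x, continuous dc}) ->
  (forall x, X0 x -> exists y, r y = Some (rc x) /\ Delta y = Some (dc x)) ->
  (forall x y y', X0 x -> r y = Some (rc x) -> Delta y = Some (dc x) ->
    r y' = Some (rc x) -> Delta y' = Some (dc x) -> y = y') ->
  exists phi : X -> Y, holomorphic_map phi /\
    forall x, X0 x -> r (phi x) = Some (rc x) /\ Delta (phi x) = Some (dc x).
Proof.
move=> cY br mD X0f rcm rcf cont ex un.
have /choice[phi0 phi0P] : forall x, exists y, X0 x -> r y = Some (rc x) /\ Delta y = Some (dc x).
  move=> x; have [/ex[y yP]|nX] := pselect (X0 x); first by exists y.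
  have [x' /contrapT /ex[y _] _] := cofinite_dense X0f (@filterT _ (nbhs x) _).
  by exists y => /nX.
have near0 := near_X0 X0f.
have c0 x : X0 x -> {for x, continuous phi0}.
  move=> Xx; have [crc cdc] := cont _ Xx; have [rx Dx] := phi0P _ Xx.
  apply: (@lift_continuous X Y (S * S)%type (fun y => (r y, Delta y))
    (fun x => (Some (rc x), Some (dc x)))); first exact: cY.
  - by apply: hausdorff_prod; exact: sphere_hausdorff.
  - move=> y; apply: continuous_pair; first by have h := covering_continuous br; exact: (h y).
    by have h := meromorphic_continuous mD; exact: (h y).
  - apply: continuous_pair.
      by apply: (@continuous_comp _ C S rc Some); [exact: crc|exact: Some_continuous].
    by apply: (@continuous_comp _ C S dc Some); [exact: cdc|exact: Some_continuous].
  - apply: filterS (near0 x) => x' h.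
    have [->|/h /phi0P[-> ->] //] := pselect (x' = x); by rewrite rx Dx.
  - by move=> y [ry Dy]; exact: un Xx ry Dy rx Dx.
have [phi [hphi phiE]] := holomorphic_extension cY br X0f c0 (fun x Xx => (phi0P x Xx).1) rcm rcf.
by exists phi; split=> // x Xx; rewrite phiE //; exact: phi0P.
Qed.

End lift.

(** * The algebra of the two curves *)

Section algebra.
Variables (R : realType).
Local Notation C := (cplx R).
Variables (c d s1 s2 s3 s4 : C) (Pi4 P1 P2 K2 : {poly C}).
Hypotheses (Pi4E : Pi4 = 'X^4 - s1 *: 'X^3 + s2 *: 'X^2 - s3 *: 'X + s4%:P)
    (P1E : P1 = 'X - c%:P)
    (P2E : P2 = 'X^2 - ((s1 + 2 * c) / 3) *: 'X + d%:P)
    (K2E : K2 = 3 *: 'X^2 + (2 * (c - s1)) *: 'X + (- (3 * d) + s2)%:P).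

Let horner_simp := (hornerD, hornerN, hornerX, hornerC, hornerXn, hornerZ, hornerM,
  horner_exp, hornerMn).

Lemma Pi4_horner x : Pi4.[x] = x ^+ 4 - s1 * x ^+ 3 + s2 * x ^+ 2 - s3 * x + s4.
Proof. by rewrite Pi4E !horner_simp. Qed.

Lemma dPi4_horner x : Pi4^`().[x] = 4 * x ^+ 3 - 3 * s1 * x ^+ 2 + 2 * s2 * x - s3.
Proof.
rewrite Pi4E !(derivD, derivN, derivZ, derivXn, derivX, derivC) /=.
rewrite !horner_simp; ring.
Qed.

Lemma K2_horner x : K2.[x] = 3 * x ^+ 2 + 2 * (c - s1) * x + (- (3 * d) + s2).
Proof. by rewrite K2E !horner_simp. Qed.

Lemma eval_cubic z h : eval2 (cubic_curve Pi4 P2 P1) z h =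
  Pi4.[z] * h ^+ 3 - 3 * P2.[z] * h + 2 * P1.[z].
Proof. by rewrite /eval2 /cubic_curve !horner_simp. Qed.

Lemma eval_hyperelliptic x D : eval2 (hyperelliptic_curve Pi4 K2) x D =
  D ^+ 2 - Pi4^`().[x] ^+ 2 + 4 * Pi4.[x] * K2.[x].
Proof. by rewrite /eval2 /hyperelliptic_curve !horner_simp mulrA. Qed.

(** Taylor's formula for Pi4 at x: in the variables x and xi = 1/h, with
    z = x + xi, the cubic becomes quadratic in xi. *)
Lemma cubic_taylor x xi : xi != 0 ->
  eval2 (cubic_curve Pi4 P2 P1) (x + xi) xi^-1 =
  (Pi4.[x] + Pi4^`().[x] * xi + K2.[x] * xi ^+ 2) / xi ^+ 3.
Proof.
move=> xi0; rewrite eval_cubic !Pi4_horner dPi4_horner K2_horner P1E P2E !horner_simp.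
by field.
Qed.

Lemma cubicE z h : h != 0 -> eval2 (cubic_curve Pi4 P2 P1) z h =
  (Pi4.[z - h^-1] + Pi4^`().[z - h^-1] / h + K2.[z - h^-1] / h ^+ 2) * h ^+ 3.
Proof.
move=> h0; have := @cubic_taylor (z - h^-1) h^-1.
by rewrite invr_eq0 => /(_ h0); rewrite subrK invrK !exprVn invrK.
Qed.

Lemma hyperelliptic_of_cubic z h : h != 0 ->
  eval2 (hyperelliptic_curve Pi4 K2) (z - h^-1)
    (2 * K2.[z - h^-1] / h + Pi4^`().[z - h^-1]) * h ^+ 3 =
  4 * K2.[z - h^-1] * eval2 (cubic_curve Pi4 P2 P1) z h.
Proof.
move=> h0; rewrite cubicE // eval_hyperelliptic.
by move: (Pi4.[_]) (Pi4^`().[_]) (K2.[_]) => p p' k; field.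
Qed.

(** On the hyperelliptic curve (D - Pi4')(D + Pi4') = - 4 Pi4 K2, which makes
    (D - Pi4') / (2 K2) and - 2 Pi4 / (D + Pi4') two expressions of the same
    1/h. *)
Lemma inverse_formulas x D (p := Pi4.[x]) (p' := Pi4^`().[x]) (k := K2.[x])
    (z := x + (- p' + D) / (2 * k)) (h := - ((p' + D) / (2 * p))) :
  k != 0 -> p != 0 -> eval2 (hyperelliptic_curve Pi4 K2) x D = 0 ->
  [/\ h != 0, z - h^-1 = x, 2 * k / h + p' = D &
      eval2 (cubic_curve Pi4 P2 P1) z h = 0].
Proof.
move=> k0 p0; rewrite eval_hyperelliptic -/p -/p' -/k => e.
have two0 : 2 != 0 :> C by rewrite pnatr_eq0.
have e' : (D - p') * (p' + D) = - (4 * p * k).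
  by apply/eqP; rewrite -subr_eq0 -e; apply/eqP; ring.
have pD : p' + D != 0.
  apply/eqP => s0; move/eqP: e'; rewrite s0 mulr0 eq_sym oppr_eq0 !mulf_eq0.
  by rewrite (negbTE p0) (negbTE k0) pnatr_eq0.
have h0 : h != 0 by rewrite /h oppr_eq0 mulf_neq0 // invr_eq0 mulf_neq0.
have hV : h^-1 = (- p' + D) / (2 * k).
  rewrite /h; apply: (mulIf (mulf_neq0 pD (mulf_neq0 two0 k0))).
  transitivity (- (4 * p * k)); first by field; rewrite pD p0.
  by rewrite -e'; field; rewrite k0.
have zx : z - h^-1 = x by rewrite hV /z addrK.
have D_E : 2 * k / h + p' = D by rewrite hV; field.
split=> //; have := hyperelliptic_of_cubic z h0; rewrite zx -/k -/p' D_E.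
rewrite eval_hyperelliptic -/p -/p' -/k e mul0r => /esym/eqP.
by rewrite !mulf_eq0 (negbTE k0) pnatr_eq0 /= => /eqP.
Qed.

(** D is a square root of the discriminant of the quadratic equation satisfied
    by 1/h, and its two expressions give back z and h. *)
Lemma direct_formulas z h (x := z - h^-1) (D := 2 * K2.[x] / h + Pi4^`().[x]) :
  h != 0 -> eval2 (cubic_curve Pi4 P2 P1) z h = 0 -> K2.[x] != 0 -> Pi4.[x] != 0 ->
  [/\ eval2 (hyperelliptic_curve Pi4 K2) x D = 0,
      x + (- Pi4^`().[x] + D) / (2 * K2.[x]) = z &
      - ((Pi4^`().[x] + D) / (2 * Pi4.[x])) = h].
Proof.
move=> h0 e k0 p0; split.
- have := hyperelliptic_of_cubic z h0; rewrite e mulr0 => /eqP.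
  by rewrite mulf_eq0 expf_eq0 (negbTE h0) orbF => /eqP.
- rewrite /D; have -> : z = x + h^-1 by rewrite /x subrK.
  by field; rewrite h0 k0.
move: e; rewrite cubicE // -/x /D => /eqP; rewrite mulf_eq0 expf_eq0 (negbTE h0) orbF => /eqP e.
have -> : Pi4^`().[x] + (2 * K2.[x] / h + Pi4^`().[x]) =
   2 * h * (Pi4.[x] + Pi4^`().[x] / h + K2.[x] / h ^+ 2 - Pi4.[x]) by field.
by rewrite e sub0r; field.
Qed.

Hypothesis irr : irreducible2 (cubic_curve Pi4 P2 P1).

Lemma poly2_unit_coef (P : {poly {poly C}}) i :
  P \is a GRing.unit -> (0 < i)%N -> P`_i = 0.
Proof.
rewrite poly_unitE => /andP[/eqP sP _] i0.
by apply: nth_default; rewrite sP.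
Qed.

(** If Pi4, Pi4' and K2 all vanished at x, then h = 1/(z - x) would solve the
    cubic identically, and (z - x) h - 1 would divide it. *)
Lemma quadratic_neq0 x :
  (Pi4.[x])%:P + Pi4^`().[x] *: 'X + K2.[x] *: 'X^2 != 0 :> {poly C}.
Proof.
apply/eqP => e.
have e0 : Pi4.[x] = 0.
  by move/(congr1 (fun p : {poly C} => p`_0)): e; rewrite !coefE /= !mulr0 !addr0.
have e1 : Pi4^`().[x] = 0.
  by move/(congr1 (fun p : {poly C} => p`_1)): e; rewrite !coefE /= mulr1 mulr0 addr0 add0r.
have e2 : K2.[x] = 0.
  by move/(congr1 (fun p : {poly C} => p`_2)): e; rewrite !coefE /= mulr1 mulr0 !add0r.
move: e0 e1 e2; rewrite Pi4_horner dPi4_horner K2_horner => e0 e1 e2.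
pose q : {poly C} := 'X^2 + (2 * x - s1) *: 'X + (3 * x ^+ 2 - 2 * s1 * x + s2)%:P.
pose A : {poly {poly C}} := ('X - x%:P)%:P * 'X - 1.
pose B : {poly {poly C}} := (('X - x%:P) * q)%:P * 'X^2 + q%:P * 'X - (2 *: P1)%:P.
have s3E : s3 = 4 * x ^+ 3 - 3 * s1 * x ^+ 2 + 2 * s2 * x.
  by apply/eqP; rewrite eq_sym -subr_eq0 e1.
have s4E : s4 = - (x ^+ 4 - s1 * x ^+ 3 + s2 * x ^+ 2 - s3 * x).
  by apply/eqP; rewrite eq_sym -subr_eq0 -opprD e0 oppr0.
have dE : 3 * d = 3 * x ^+ 2 + 2 * (c - s1) * x + s2.
  by apply/eqP; rewrite eq_sym -subr_eq0 -[X in _ == X]e2; apply/eqP; ring.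
have Pi4q : Pi4 = ('X - x%:P) ^+ 2 * q.
  rewrite Pi4E /q s4E s3E -!mul_polyC; ring.
have P2q : 3 *: P2 = q + 2 *: (P1 * ('X - x%:P)).
  have -> : 3 *: P2 = 3 *: 'X^2 - (s1 + 2 * c) *: 'X + (3 * d)%:P.
    rewrite P2E scalerDr scalerBr scalerA mulrCA mulfV ?mulr1 ?pnatr_eq0 //.
    by rewrite polyCM mul_polyC.
  by rewrite dE P1E /q -!mul_polyC; ring.
have PAB : cubic_curve Pi4 P2 P1 = A * B.
  rewrite /cubic_curve Pi4q P2q /A /B -!mul_polyC; ring.
have [_ _ /(_ _ _ PAB)] := irr; case=> /poly2_unit_coef.
  move=> /(_ 1%N isT); rewrite /A coefB coefMX coefC coef1 /= subr0 => /eqP.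
  by rewrite polyXsubC_eq0.
move=> /(_ 2 isT); rewrite /B coefB coefD coefMXn coefMX !coefC /= addr0 subr0 => Bq.
have : Pi4 = 0 by rewrite Pi4q expr2 -mulrA Bq mulr0.
move/(congr1 (fun p : {poly C} => p`_4)); rewrite Pi4E !coefE /= !mulr0 !addr0 !subr0.
by move/eqP; rewrite oner_eq0.
Qed.

(** If all the coefficients vanished at z, they would have a common factor. *)
Lemma fibre_cubic_neq0 z :
  Pi4.[z] *: 'X^3 - (3 * P2.[z]) *: 'X + (2 * P1.[z])%:P != 0 :> {poly C}.
Proof.
apply/eqP => e.
have e0 : P1.[z] = 0.
  move/(congr1 (fun p : {poly C} => p`_0)): e; rewrite !coefE /= !mulr0 subr0 add0r => /eqP.
  by rewrite mulf_eq0 pnatr_eq0 => /eqP.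
have e1 : P2.[z] = 0.
  move/(congr1 (fun p : {poly C} => p`_1)): e; rewrite !coefE /= mulr1 mulr0 addr0 add0r => /eqP.
  by rewrite oppr_eq0 mulf_eq0 pnatr_eq0 => /eqP.
have e3 : Pi4.[z] = 0.
  by move/(congr1 (fun p : {poly C} => p`_3)): e; rewrite !coefE /= mulr1 mulr0 addr0 subr0.
have /factor_theorem[u1 P1u] : root P1 z by apply/eqP.
have /factor_theorem[u2 P2u] : root P2 z by apply/eqP.
have /factor_theorem[u4 Pi4u] : root Pi4 z by apply/eqP.
pose B : {poly {poly C}} := u4%:P * 'X^3 - (3 *: u2)%:P * 'X + (2 *: u1)%:P.
have PAB : cubic_curve Pi4 P2 P1 = ('X - z%:P)%:P * B.
  rewrite /cubic_curve P1u P2u Pi4u /B -!mul_polyC; ring.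
have [_ _ /(_ _ _ PAB)] := irr; case=> [|/poly2_unit_coef].
  rewrite poly_unitE coefC /= => /andP[_]; rewrite poly_unitE size_XsubC //.
move=> /(_ 3 isT); rewrite /B coefD coefB coefMXn coefMX !coefC /= addr0 subr0 => u40.
move: Pi4u; rewrite u40 mul0r.
move/(congr1 (fun p : {poly C} => p`_4)); rewrite Pi4E !coefE /= !mulr0 !addr0 !subr0.
by move/eqP; rewrite oner_eq0.
Qed.

(** These z = x + xi, with xi = 1/h, come from the roots xi of the quadratic. *)
Lemma finite_z_over x : finite_set [set z | exists h, [/\ h != 0,
  eval2 (cubic_curve Pi4 P2 P1) z h = 0 & z - h^-1 = x]].
Proof.
apply: (@sub_finite_set _ _ ((fun xi => x + xi) @`
  [set xi | ((Pi4.[x])%:P + Pi4^`().[x] *: 'X + K2.[x] *: 'X^2).[xi] = 0])); last first.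
  by apply: finite_image; apply: finite_roots; exact: quadratic_neq0.
move=> z [h [h0 e zx]]; exists h^-1; last by rewrite -zx subrK.
move: e; rewrite cubicE // zx => /eqP; rewrite mulf_eq0 expf_eq0 (negbTE h0) orbF.
by rewrite /= !horner_simp exprVn => /eqP.
Qed.

(** These x = z - 1/h come from the roots h of the cubic at z. *)
Lemma finite_x_over z : finite_set [set x | exists h, [/\ h != 0,
  eval2 (cubic_curve Pi4 P2 P1) z h = 0 & z - h^-1 = x]].
Proof.
apply: (@sub_finite_set _ _ ((fun h => z - h^-1) @`
  [set h | (Pi4.[z] *: 'X^3 - (3 * P2.[z]) *: 'X + (2 * P1.[z])%:P).[h] = 0])); last first.
  by apply: finite_image; apply: finite_roots; exact: fibre_cubic_neq0.
move=> x [h [h0 e zx]]; exists h => //.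
by move: e; rewrite eval_cubic /= !horner_simp.
Qed.

Lemma K2_neq0 : K2 != 0.
Proof.
apply/eqP => /(congr1 (fun p : {poly C} => p`_2)); rewrite K2E !coefE /= mulr1 mulr0 !addr0.
by move/eqP; rewrite pnatr_eq0.
Qed.

Lemma Pi4_neq0 : Pi4 != 0.
Proof.
apply/eqP => /(congr1 (fun p : {poly C} => p`_4)); rewrite Pi4E !coefE /= !mulr0 !addr0 !subr0.
by move/eqP; rewrite oner_eq0.
Qed.

End algebra.

(** * The conformal equivalence *)

Section fibres.
Variables (R : realType) (X : riemann_surface R) (z h : X -> sphere R).
Local Notation C := (cplx R).
Variable P : {poly {poly C}}.

Definition good_fibre (z0 : C) : Prop :=
  set_bij (z @^-1` [set Some z0]) (Some @` [set h0 | eval2 P z0 h0 = 0]) h.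

Lemma good_fibre_value z0 x : good_fibre z0 -> z x = Some z0 ->
  exists2 h0, h x = Some h0 & eval2 P z0 h0 = 0.
Proof. by move=> [fh _ _] zx; have [h0 e <-] := fh x zx; exists h0. Qed.

Lemma good_fibre_point z0 h0 : good_fibre z0 -> eval2 P z0 h0 = 0 ->
  exists x, z x = Some z0 /\ h x = Some h0.
Proof.
move=> [_ _ sh] e; have [|x zx hx] := sh (Some h0); first by exists h0.
by exists x.
Qed.

Lemma good_fibre_inj z0 x x' : good_fibre z0 -> z x = Some z0 -> z x' = Some z0 ->
  h x = h x' -> x = x'.
Proof. by move=> [_ ih _] zx zx'; apply: ih; exact/mem_set. Qed.

End fibres.

Section equivalence.
Variables (R : realType) (c d s1 s2 s3 s4 : cplx R) (Pi4 P1 P2 K2 : {poly cplx R}).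
Local Notation C := (cplx R).
Hypotheses (Pi4E : Pi4 = 'X^4 - s1 *: 'X^3 + s2 *: 'X^2 - s3 *: 'X + s4%:P)
    (P1E : P1 = 'X - c%:P)
    (P2E : P2 = 'X^2 - ((s1 + 2 * c) / 3) *: 'X + d%:P)
    (K2E : K2 = 3 *: 'X^2 + (2 * (c - s1)) *: 'X + (- (3 * d) + s2)%:P).
Local Notation P := (cubic_curve Pi4 P2 P1).
Local Notation Q := (hyperelliptic_curve Pi4 K2).
Hypothesis irr : irreducible2 P.
Variables (X : riemann_surface R) (z h : X -> sphere R).
Variables (Y : riemann_surface R) (r Delta : Y -> sphere R).
Hypotheses (cX : compact [set: X]) (bz : branched_covering z) (mh : meromorphic h).
Hypothesis zgood : finite_set [set z0 | ~ good_fibre z h P z0].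
Hypotheses (cY : compact [set: Y]) (br : branched_covering r) (mD : meromorphic Delta).
Hypothesis rgood : finite_set [set r0 | ~ good_fibre r Delta Q r0].

(** Removing c ensures h <> 0, since the cubic at h = 0 is 2 (z - c). *)
Definition bad_z : set C := [set z0 | ~ good_fibre z h P z0] `|` [set c].
Definition bad_r : set C := [set r0 | ~ good_fibre r Delta Q r0] `|`
  ([set r0 | K2.[r0] = 0] `|` [set r0 | Pi4.[r0] = 0]).

Lemma bad_z_finite : finite_set bad_z.
Proof. by rewrite finite_setU; split=> //; exact: finite_set1. Qed.

Lemma bad_r_finite : finite_set bad_r.
Proof.
rewrite !finite_setU; split=> //; split; apply: finite_roots.
  exact: (K2_neq0 K2E).
exact: (Pi4_neq0 Pi4E).
Qed.

Lemma good_z z0 : ~ bad_z z0 -> good_fibre z h P z0 /\ z0 <> c.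
Proof. by move=> /not_orP[/contrapT g zc]. Qed.

Lemma good_r r0 : ~ bad_r r0 -> [/\ good_fibre r Delta Q r0, K2.[r0] != 0 & Pi4.[r0] != 0].
Proof. by move=> /not_orP[/contrapT g /not_orP[k p]]; split=> //; exact/eqP. Qed.

(** X0 and Y0 are cofinite, and the formulas are bijections between them inverse
    to each other; the conditions on the image are part of the definitions for
    that reason. *)
Definition X0 : set X := [set x | exists z0 h0, [/\ z x = Some z0, h x = Some h0,
  h0 != 0, eval2 P z0 h0 = 0 & ~ bad_z z0 /\ ~ bad_r (z0 - h0^-1)]].

Definition Zr (r0 D0 : C) : C := r0 + (- Pi4^`().[r0] + D0) / (2 * K2.[r0]).
Definition Hr (r0 D0 : C) : C := - ((Pi4^`().[r0] + D0) / (2 * Pi4.[r0])).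

Definition Y0 : set Y := [set y | exists r0 D0, [/\ r y = Some r0, Delta y = Some D0,
  eval2 Q r0 D0 = 0 & ~ bad_r r0 /\ ~ bad_z (Zr r0 D0)]].

(** An excluded value of r = z - 1/h is only taken over finitely many z, and z has
    finite fibres. *)
Lemma X0_cofinite : finite_set (~` X0).
Proof.
pose A r0 : set C := [set z0 | exists h0, [/\ h0 != 0, eval2 P z0 h0 = 0 & z0 - h0^-1 = r0]].
apply: (@sub_finite_set _ _ (z @^-1` ([set None] `|` Some @` (bad_z `|` \bigcup_(r0 in bad_r) A r0)))).
  move=> x nX /=; case zx : (z x) => [z0|]; [right|by left].
  exists z0 => //; apply: contrapT => /not_orP[zg nA].
  have [g zc] := good_z zg; have [h0 hx e] := good_fibre_value g zx.
  have h00 : h0 != 0.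
    apply/eqP => h00; move: e; rewrite h00 eval_cubic expr0n !mulr0 subr0 add0r P1E.
    rewrite hornerD hornerN hornerX hornerC => /eqP.
    by rewrite mulf_eq0 pnatr_eq0 subr_eq0 => /eqP.
  apply: nX; exists z0, h0; split=> //; split=> // rb; apply: nA.
  by exists (z0 - h0^-1) => //; exists h0.
apply: preimage_finite => //; rewrite finite_setU; split; first exact: finite_set1.
apply: finite_image; rewrite finite_setU; split; first exact: bad_z_finite.
apply: bigcup_finite; first exact: bad_r_finite.
by move=> r0 _; exact: (finite_z_over Pi4E P1E P2E K2E irr).
Qed.

Lemma Hr_ZrP r0 D0 : eval2 Q r0 D0 = 0 -> ~ bad_r r0 ->
  [/\ Hr r0 D0 != 0, Zr r0 D0 - (Hr r0 D0)^-1 = r0,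
      2 * K2.[r0] / Hr r0 D0 + Pi4^`().[r0] = D0 & eval2 P (Zr r0 D0) (Hr r0 D0) = 0].
Proof.
by move=> e /good_r[_ k p]; exact: (inverse_formulas Pi4E P1E P2E K2E k p e).
Qed.

(** An excluded value of z is only taken over finitely many values of r. *)
Lemma Y0_cofinite : finite_set (~` Y0).
Proof.
pose A z0 : set C := [set r0 | exists h0, [/\ h0 != 0, eval2 P z0 h0 = 0 & z0 - h0^-1 = r0]].
apply: (@sub_finite_set _ _ (r @^-1` ([set None] `|` Some @` (bad_r `|` \bigcup_(z0 in bad_z) A z0)))).
  move=> y nY /=; case ry : (r y) => [r0|]; [right|by left].
  exists r0 => //; apply: contrapT => /not_orP[rg nA].
  have [g _ _] := good_r rg; have [D0 Dy e] := good_fibre_value g ry.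
  apply: nY; exists r0, D0; split=> //; split=> // zb; apply: nA.
  exists (Zr r0 D0) => //; exists (Hr r0 D0).
  by have [] := Hr_ZrP e rg.
apply: preimage_finite => //; rewrite finite_setU; split; first exact: finite_set1.
apply: finite_image; rewrite finite_setU; split; first exact: bad_r_finite.
apply: bigcup_finite; first exact: bad_z_finite.
by move=> z0 _; exact: (finite_x_over Pi4E irr).
Qed.

Let rc x : C := fin (z x) - (fin (h x))^-1.
Let dc x : C := 2 * K2.[rc x] / fin (h x) + Pi4^`().[rc x].
Let zc y : C := Zr (fin (r y)) (fin (Delta y)).
Let hc y : C := Hr (fin (r y)) (fin (Delta y)).

Lemma near_h x : \forall x' \near x, x' <> x -> h x' <> None /\ fin (h x') != 0.
Proof.
have := near_X0 X0_cofinite x; apply: filterS => x' h' /h'[z0 [h0 [_ -> h00 _ _]]].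
by [].
Qed.

Lemma near_chart_punctured (Z : riemann_surface R) (t : chart R Z) x (P : set Z) :
  chart_dom t x -> (\forall x' \near x, x' <> x -> P x') ->
  \forall w \near t x, w != t x -> P (chart_param t w).
Proof.
move=> tx H; have h' := near_chart_param tx H.
apply: (@filterS _ (nbhs (t x)) _ _ _ _ h') => w [_ wK hw] wx; apply: hw => e.
by move: wx; rewrite -wK e eqxx.
Qed.

Lemma phi_exists : exists phi : X -> Y, holomorphic_map phi /\
  forall x, X0 x -> r (phi x) = Some (rc x) /\ Delta (phi x) = Some (dc x).
Proof.
have X0D x : X0 x -> exists z0 h0, [/\ z x = Some z0, h x = Some h0, h0 != 0,
    rc x = z0 - h0^-1 /\ dc x = 2 * K2.[z0 - h0^-1] / h0 + Pi4^`().[z0 - h0^-1] &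
    [/\ good_fibre r Delta Q (rc x), eval2 P z0 h0 = 0 & eval2 Q (rc x) (dc x) = 0]].
  move=> [z0 [h0 [zx hx h00 e [_ rb]]]]; exists z0, h0.
  have rcE : rc x = z0 - h0^-1 by rewrite /rc zx hx.
  have dcE : dc x = 2 * K2.[z0 - h0^-1] / h0 + Pi4^`().[z0 - h0^-1] by rewrite /dc rcE hx.
  have [g k p] := good_r rb.
  split=> //; rewrite rcE dcE; split=> //.
  by have [] := direct_formulas Pi4E P1E P2E K2E h00 e k p.
apply: (holomorphic_lift cY br mD X0_cofinite).
- move=> t x tA tx.
  have hN : \forall x' \near x, x' <> x -> h x' <> None.
    by apply: filterS (near_h x) => x' H /H[].
  have mhc := meromorphic_mero mh tA tx hN.
  have h0 : \forall w \near t x, w != t x -> fin (h (chart_param t w)) != 0.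
    apply: (@near_chart_punctured X t x (fun x' => fin (h x') != 0) tx).
    by apply: filterS (near_h x) => x' H /H[].
  apply: (meroD (covering_mero bz tA tx)).
  have := meroM (mero_cst (-1) (t x)) (meroV h0 mhc).
  by apply: mero_near; apply: (@filterE _ (nbhs (t x))) => w _; rewrite mulN1r.
- move=> v; apply: sub_finite_set (preimage_finite cX bz
    (finite_image Some (finite_z_over Pi4E P1E P2E K2E irr v))).
  move=> x [/X0D[z0 [h0 [zx hx h00 [rcE _] [_ e _]]]] rv] /=.
  by exists z0 => //; exists h0; rewrite -rcE.
- move=> x /X0D[z0 [h0 [zx hx h00 _ _]]].
  have ch : {for x, continuous (fun x => fin (h x))}.
    by have H := meromorphic_continuous mh; exact: (continuous_fin hx (H x)).
  have cz : {for x, continuous (fun x => fin (z x))}.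
    by have H := covering_continuous bz; exact: (continuous_fin zx (H x)).
  have fh0 : fin (h x) != 0 by rewrite hx.
  have cV := @continuousV_at R X (fun x => fin (h x)) x fh0 ch.
  have crc : {for x, continuous rc} := continuousD_at cz (continuousN_at cV).
  split; first exact: crc.
  apply: continuousD_at; last exact: continuous_hornerC.
  apply: (continuousM_at _ cV); apply: continuousM_at; first exact: continuous_cst_at.
  exact: continuous_hornerC.
- move=> x /X0D[z0 [h0 [_ _ _ _ [g _ e]]]].
  exact: good_fibre_point g e.
move=> x y y' /X0D[z0 [h0 [_ _ _ _ [g _ e]]]] ry Dy ry' Dy'.
by apply: (good_fibre_inj g ry ry'); rewrite Dy Dy'.
Qed.

Lemma psi_exists : exists psi : Y -> X, holomorphic_map psi /\
  forall y, Y0 y -> z (psi y) = Some (zc y) /\ h (psi y) = Some (hc y).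
Proof.
have Y0D y : Y0 y -> exists r0 D0, [/\ r y = Some r0, Delta y = Some D0,
    zc y = Zr r0 D0 /\ hc y = Hr r0 D0, K2.[r0] != 0 /\ Pi4.[r0] != 0 &
    [/\ good_fibre z h P (zc y), eval2 P (zc y) (hc y) = 0, hc y != 0 & zc y - (hc y)^-1 = r0]].
  move=> [r0 [D0 [ry Dy e [rb zb]]]]; exists r0, D0.
  have zcE : zc y = Zr r0 D0 by rewrite /zc ry Dy.
  have hcE : hc y = Hr r0 D0 by rewrite /hc ry Dy.
  have [_ k p] := good_r rb; have [g _] := good_z zb.
  have [h0 zr _ e'] := Hr_ZrP e rb.
  by rewrite zcE hcE.
have nearY y : \forall y' \near y, y' <> y -> Delta y' <> None /\ K2.[fin (r y')] != 0.
  have := near_X0 Y0_cofinite y; apply: filterS => y' H /H /Y0D[r0 [D0 [ry Dy _ [k _] _]]].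
  by rewrite ry Dy.
have two0 : 2 != 0 :> C by rewrite pnatr_eq0.
apply: (holomorphic_lift cX bz mh Y0_cofinite).
- move=> t y tA ty.
  have DN : \forall y' \near y, y' <> y -> Delta y' <> None.
    by apply: filterS (nearY y) => y' H /H[].
  have mDc := meromorphic_mero mD tA ty DN.
  have mrc := covering_mero br tA ty.
  have K0 : \forall w \near t y, w != t y -> 2 * K2.[fin (r (chart_param t w))] != 0.
    apply: (@near_chart_punctured Y t y (fun y' => 2 * K2.[fin (r y')] != 0) ty).
    apply: filterS (nearY y) => y' H /H[_ k].
    by rewrite mulf_neq0.
  apply: (meroD mrc); apply: meroM.
    apply: meroD mDc.
    have := meroM (mero_cst (-1) (t y)) (mero_horner Pi4^`() mrc).
    by apply: mero_near; apply: (@filterE _ (nbhs (t y))) => w _; rewrite mulN1r.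
  exact: (meroV K0 (meroM (mero_cst 2 _) (mero_horner K2 mrc))).
- move=> v; apply: sub_finite_set (preimage_finite cY br
    (finite_image Some (finite_x_over Pi4E irr v))).
  move=> y [/Y0D[r0 [D0 [ry Dy _ _ [_ e h0 zr]]]] zv] /=.
  by exists r0 => //; exists (hc y); rewrite -zv.
- move=> y /Y0D[r0 [D0 [ry Dy _ [k p] _]]].
  have cD : {for y, continuous (fun y => fin (Delta y))}.
    by have H := meromorphic_continuous mD; exact: (continuous_fin Dy (H y)).
  have cr : {for y, continuous (fun y => fin (r y))}.
    by have H := covering_continuous br; exact: (continuous_fin ry (H y)).
  have cdP := @continuous_hornerC R Y Pi4^`() (fun y => fin (r y)) y cr.
  have c2 (p0 : {poly C}) : p0.[r0] != 0 ->
      {for y, continuous (fun y => (2 * p0.[fin (r y)])^-1)}.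
    move=> p00; apply: continuousV_at; first by rewrite ry mulf_neq0.
    apply: continuousM_at; first exact: continuous_cst_at.
    exact: continuous_hornerC.
  split.
    apply: (continuousD_at cr); apply: continuousM_at; last exact: c2.
    exact: (continuousD_at (continuousN_at cdP) cD).
  apply: continuousN_at; apply: continuousM_at; last exact: c2.
  exact: (continuousD_at cdP cD).
- move=> y /Y0D[r0 [D0 [_ _ _ _ [g e _ _]]]].
  exact: good_fibre_point g e.
move=> y x x' /Y0D[r0 [D0 [_ _ _ _ [g _ _ _]]]] zx hx zx' hx'.
by apply: (good_fibre_inj g zx zx'); rewrite hx hx'.
Qed.

(** The lifts phi and psi are inverse to each other on cofinite sets by the
    algebraic formulas, hence everywhere by continuity. *)
Lemma birational_equivalence : exists (phi : X -> Y) (psi : Y -> X),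
    [/\ conformal_equivalence phi psi,
        generically (fun x : X => exists z0 h0 : cplx R,
          [/\ z x = Some z0, h x = Some h0, h0 != 0,
              r (phi x) = Some (z0 - h0^-1) &
              Delta (phi x) =
                Some (2 * K2.[z0 - h0^-1] / h0 + Pi4^`().[z0 - h0^-1])]) &
        generically (fun y : Y => exists r0 D0 : cplx R,
          [/\ r y = Some r0, Delta y = Some D0,
              K2.[r0] != 0 /\ Pi4.[r0] != 0,
              z (psi y) = Some (r0 + (- Pi4^`().[r0] + D0) / (2 * K2.[r0])) &
              h (psi y) = Some (- ((Pi4^`().[r0] + D0) / (2 * Pi4.[r0])))])].
Proof.
have [phi [hphi phiE]] := phi_exists; have [psi [hpsi psiE]] := psi_exists.
have phiK : forall x, ~ (~` X0) x -> psi (phi x) = x.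
  move=> x /contrapT Xx; have [rp Dp] := phiE x Xx.
  have [z0 [h0 [zx hx h00 e [zb rb]]]] := Xx.
  have [g k p] := good_r rb.
  have [eQ zE hE] := direct_formulas Pi4E P1E P2E K2E h00 e k p.
  move: rp Dp; rewrite /dc /rc zx hx /= => rp Dp.
  have Yy : Y0 (phi x).
    by exists (z0 - h0^-1), (2 * K2.[z0 - h0^-1] / h0 + Pi4^`().[z0 - h0^-1]); rewrite /Zr zE.
  have [zp hp] := psiE _ Yy; move: zp hp; rewrite /zc /hc /Zr /Hr rp Dp /= zE hE => zp hp.
  by have [gz _] := good_z zb; apply: (good_fibre_inj gz zp zx); rewrite hp hx.
have psiK : forall y, ~ (~` Y0) y -> phi (psi y) = y.
  move=> y /contrapT Yy; have [zp hp] := psiE y Yy.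
  have [r0 [D0 [ry Dy e [rb zb]]]] := Yy.
  have [h0 zr D_E eP] := Hr_ZrP e rb.
  move: zp hp; rewrite /zc /hc ry Dy /= => zp hp.
  have Xx : X0 (psi y) by exists (Zr r0 D0), (Hr r0 D0); rewrite zr.
  have [rp Dp] := phiE _ Xx; move: rp Dp; rewrite /dc /rc zp hp /= zr D_E => rp Dp.
  by have [g _ _] := good_r rb; apply: (good_fibre_inj g rp ry); rewrite Dp Dy.
have cphi := hphi.1; have cpsi := hpsi.1.
exists phi, psi; split.
- have cid (Z : riemann_surface R) : continuous (@id Z) by move=> x; exact: cvg_id.
  have cX' : continuous (psi \o phi).
    by move=> x; apply: continuous_comp; [exact: cphi|exact: cpsi].
  have cY' : continuous (phi \o psi).
    by move=> y; apply: continuous_comp; [exact: cpsi|exact: cphi].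
  split; [| |exact: hphi|exact: hpsi].
    exact: (continuous_eq_cofinite X0_cofinite cX' (cid X) phiK).
  exact: (continuous_eq_cofinite Y0_cofinite cY' (cid Y) psiK).
- apply: sub_finite_set X0_cofinite => x nx Xx; apply: nx.
  have [rp Dp] := phiE x Xx; have [z0 [h0 [zx hx h00 _ _]]] := Xx.
  by exists z0, h0; move: rp Dp; rewrite /dc /rc zx hx.
apply: sub_finite_set Y0_cofinite => y ny Yy; apply: ny.
have [zp hp] := psiE y Yy; have [r0 [D0 [ry Dy _ [rb _]]]] := Yy.
have [_ k p] := good_r rb.
by exists r0, D0; move: zp hp; rewrite /zc /hc ry Dy.
Qed.

End equivalence.

Theorem theorem1p1 (R : realType)
    (a1 b1 a2 b2 c d s1 s2 s3 s4 : cplx R) (Pi4 P1 P2 K2 : {poly cplx R})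
    (Pi4_prod : Pi4 = ('X - a1%:P) * ('X - b1%:P) * (('X - a2%:P) * ('X - b2%:P)))
    (Pi4_coef : Pi4 = 'X^4 - s1 *: 'X^3 + s2 *: 'X^2 - s3 *: 'X + s4%:P)
    (P1E : P1 = 'X - c%:P)
    (P2E : P2 = 'X^2 - ((s1 + 2 * c) / 3) *: 'X + d%:P)
    (K2E : K2 = 3 *: 'X^2 + (2 * (c - s1)) *: 'X + (- (3 * d) + s2)%:P)
    (irr : irreducible2 (cubic_curve Pi4 P2 P1))
    (X : riemann_surface R) (z h : X -> sphere R)
    (Xzh : riemann_surface_of (cubic_curve Pi4 P2 P1) z h)
    (Y : riemann_surface R) (r Delta : Y -> sphere R)
    (YrDelta : riemann_surface_of (hyperelliptic_curve Pi4 K2) r Delta) :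
  (exists (phi : X -> Y) (psi : Y -> X),
    [/\ conformal_equivalence phi psi,
        generically (fun x : X => exists z0 h0 : cplx R,
          [/\ z x = Some z0, h x = Some h0, h0 != 0,
              r (phi x) = Some (z0 - h0^-1) &
              Delta (phi x) =
                Some (2 * K2.[z0 - h0^-1] / h0 + Pi4^`().[z0 - h0^-1])]) &
        generically (fun y : Y => exists r0 D0 : cplx R,
          [/\ r y = Some r0, Delta y = Some D0,
              K2.[r0] != 0 /\ Pi4.[r0] != 0,
              z (psi y) = Some (r0 + (- Pi4^`().[r0] + D0) / (2 * K2.[r0])) &
              h (psi y) = Some (- ((Pi4^`().[r0] + D0) / (2 * Pi4.[r0])))])]) /\
  (forall z0 h0 r0 D0 : cplx R, h0 != 0 ->
    r0 = z0 - h0^-1 -> D0 = 2 * K2.[r0] / h0 + Pi4^`().[r0] -> K2.[r0] != 0 ->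
    (eval2 (cubic_curve Pi4 P2 P1) z0 h0 = 0 <->
     D0 ^+ 2 - Pi4^`().[r0] ^+ 2 + 4 * Pi4.[r0] * K2.[r0] = 0)).
Proof.
have [cX [bz _] mh zgood] := Xzh; have [cY [br _] mD rgood] := YrDelta.
split.
  exact: (birational_equivalence Pi4_coef P1E P2E K2E irr cX bz mh zgood cY br mD rgood).
move=> z0 h0 r0 D0 h00 -> -> k.
have := hyperelliptic_of_cubic Pi4_coef P1E P2E K2E z0 h00.
rewrite eval_hyperelliptic => H; split=> e.
  move/eqP: H; rewrite e mulr0 mulf_eq0 expf_eq0 (negbTE h00) orbF.
  by move/eqP.
move/esym/eqP: H; rewrite e mul0r !mulf_eq0 (negbTE k) pnatr_eq0 /=.
by move/eqP.
Qed.
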